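(* Let $(G,b)$ be a $\mathbb{Z}_2$-coloured graph. The graph incidence group $\Gamma(G,b)$ is finite if and only if $G$ contains neither $C_2\sqcup C_2$ nor $K_{3,6}$ as a (ordinary) graph minor.
   Context: Graphs are finite, with multiple edges allowed and no loops. $E(v)$ is the set of edges incident to $v$. A $\mathbb{Z}_2$-colouring is any function $b:V(G)\to\mathbb{Z}_2$. $\Gamma(G,b)$ is the group generated by $\{x_e:e\in E(G)\}\cup\{J\}$ with relations $J^2=x_e^2=1$, $[x_e,J]=1$, $[x_e,x_{e'}]=1$ whenever $e,e'\in E(v)$ for some vertex $v$, and $\prod_{e\in E(v)}x_e=J^{b(v)}$ for each vertex $v$. Graph minors are taken with the usual operations (edge deletion, vertex deletion, edge contraction, where contraction removes all edges parallel to the contracted edge so no loops arise). $C_2$ is the graph with two vertices and two parallel edges between them; $C_2\sqcup C_2$ is the disjoint union of two copies of $C_2$; $K_{3,6}$ is the complete bipartite graph with parts of sizes $3$ and $6$. *)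

(* Defs.v *)
From HB Require Import structures.
From mathcomp Require Import all_boot all_algebra.
From mathcomp Require Import boolp classical_sets cardinality.

Set Implicit Arguments.
Unset Strict Implicit.
Unset Printing Implicit Defensive.

Section Presentation.
Variable X : choiceType.

(* The letter (x, false) stands for the generator x, (x, true) for x^-1. *)
Definition word := seq (X * bool).

Definition letter_inv (l : X * bool) : X * bool := (l.1, ~~ l.2).
Definition word_gen (x : X) : word := [:: (x, false)].
Definition word_inv (w : word) : word := rev (map letter_inv w).
Definition word_comm (u v : word) : word := word_inv u ++ word_inv v ++ u ++ v.

Variable rel : word -> word -> Prop.

(* [presented] below is the group with generators X and relations u = v for
   [rel u v]; it is the quotient of the free monoid on the letters by this
   congruence. *)
Inductive word_eq : word -> word -> Prop :=
| word_eq_rel u v : rel u v -> word_eq u v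
| word_eq_cancel l : word_eq [:: l; letter_inv l] [::]
| word_eq_refl u : word_eq u u
| word_eq_sym u v : word_eq u v -> word_eq v u
| word_eq_trans u v w : word_eq u v -> word_eq v w -> word_eq u w
| word_eq_cat u u' v v' :
    word_eq u u' -> word_eq v v' -> word_eq (u ++ v) (u' ++ v').

Definition word_eqb (u v : word) : bool := `[< word_eq u v >].

Lemma word_eqb_refl : reflexive word_eqb.
Proof. by move=> u; apply/asboolP; apply: word_eq_refl. Qed.

Lemma word_eqb_sym : symmetric word_eqb.
Proof. by move=> u v; apply/asboolP/asboolP; apply: word_eq_sym. Qed.

Lemma word_eqb_trans : transitive word_eqb.
Proof.
by move=> v u w /asboolP uv /asboolP vw; apply/asboolP; apply: word_eq_trans vw.
Qed.

Canonical word_equiv := EquivRel word_eqb word_eqb_refl word_eqb_sym word_eqb_trans.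

Definition presented : Type := {eq_quot word_equiv}%qT.

HB.instance Definition _ := Choice.on presented.
HB.instance Definition _ := EqQuotient.on presented.

Lemma presented_eqP u v :
  (\pi_presented u = \pi_presented v)%qT <-> word_eq u v.
Proof.
split=> [/eqP|uv]; first by rewrite eqmodE => /asboolP.
by apply/eqP; rewrite eqmodE; apply/asboolP.
Qed.

Lemma presentedW (P : presented -> Prop) :
  (forall u, P (\pi_presented u)%qT) -> forall x, P x.
Proof. by move=> Ppi x; rewrite -[x]reprK. Qed.

Lemma repr_word_eq u : word_eq (repr (\pi_presented u)%qT) u.
Proof. by apply/presented_eqP; rewrite reprK. Qed.

Definition pmul (x y : presented) : presented :=
  (\pi_presented (repr x ++ repr y))%qT.
Definition pone : presented := (\pi_presented [::])%qT.
Definition pinv (x : presented) : presented :=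
  (\pi_presented (word_inv (repr x)))%qT.

Lemma pmul_pi u v :
  pmul (\pi_presented u)%qT (\pi_presented v)%qT = (\pi_presented (u ++ v))%qT.
Proof. by apply/presented_eqP; apply: word_eq_cat; apply: repr_word_eq. Qed.

Lemma pmulA : associative pmul.
Proof.
elim/presentedW=> u; elim/presentedW=> v; elim/presentedW=> w.
by rewrite !pmul_pi catA.
Qed.

Lemma pmul1x : left_id pone pmul.
Proof. by elim/presentedW=> u; rewrite pmul_pi. Qed.

Lemma pmulx1 : right_id pone pmul.
Proof. by elim/presentedW=> u; rewrite pmul_pi cats0. Qed.

Lemma letter_invK : involutive letter_inv.
Proof. by case=> x b; rewrite /letter_inv /= negbK. Qed.

Lemma word_invK : involutive word_inv.
Proof.
by move=> w; rewrite /word_inv map_rev revK mapK //; apply: letter_invK.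
Qed.

Lemma word_mulwV w : word_eq (w ++ word_inv w) [::].
Proof.
elim: w => [|l w IH]; first exact: word_eq_refl.
rewrite /word_inv /= rev_cons -cats1 catA.
apply: word_eq_trans (word_eq_cancel l).
rewrite -[[:: l; _]]/([:: l] ++ ([::] ++ [:: letter_inv l])) -cat1s.
apply: word_eq_cat; first exact: word_eq_refl.
by apply: word_eq_cat; [exact: IH | exact: word_eq_refl].
Qed.

Lemma pmulxV : right_inverse pone pinv pmul.
Proof.
move=> x; rewrite -{1}[x]reprK /pinv pmul_pi.
by apply/presented_eqP; apply: word_mulwV.
Qed.

Lemma pmulVx : left_inverse pone pinv pmul.
Proof.
move=> x; rewrite -{2}[x]reprK /pinv pmul_pi.
by apply/presented_eqP; rewrite -{2}[repr x]word_invK; apply: word_mulwV.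
Qed.

HB.instance Definition _ :=
  isGroup.Build presented pmulA pmul1x pmulx1 pmulVx pmulxV.

Definition pgen (x : X) : presented := (\pi_presented (word_gen x))%qT.

End Presentation.

Section UniversalProperty.
Local Open Scope group_scope.
Variables (X : choiceType) (rel : word X -> word X -> Prop).

Definition word_eval (H : groupType) (f : X -> H) (w : word X) : H :=
  \prod_(l <- w) (if l.2 then (f l.1)^-1 else f l.1).

Lemma word_eval_cat (H : groupType) (f : X -> H) u v :
  word_eval f (u ++ v) = word_eval f u * word_eval f v.
Proof. by rewrite /word_eval big_cat. Qed.

Lemma word_eval_eq (H : groupType) (f : X -> H) :
  (forall u v, rel u v -> word_eval f u = word_eval f v) ->
  forall u v, word_eq rel u v -> word_eval f u = word_eval f v.
Proof.
move=> fR u v; elim=> {u v} [u v /fR //|[x b]|//|u v _ -> //|u v w _ -> _ -> //|].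
  rewrite /word_eval !big_cons !big_nil /= mulg1.
  by case: b; rewrite /= ?mulVg ?mulgV.
by move=> u u' v v' _ eu _ ev; rewrite !word_eval_cat eu ev.
Qed.

Lemma word_eval_pgen (w : word X) :
  word_eval (@pgen X rel) w = (\pi_(presented rel) w)%qT.
Proof.
elim: w => [|[x b] w IH]; first by rewrite /word_eval big_nil.
rewrite -cat1s word_eval_cat IH -[in RHS]pmul_pi; congr (_ * _).
rewrite /word_eval big_seq1 /=; case: b => //.
set p := (\pi_(presented rel) (word_gen x))%qT.
apply: (mulgI p); rewrite mulgV; apply/esym.
rewrite -[LHS]/(pmul _ _) pmul_pi; apply/presented_eqP; exact: (word_mulwV rel (word_gen x)).
Qed.

Lemma presented_relP u v :
  rel u v -> word_eval (@pgen X rel) u = word_eval (@pgen X rel) v.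
Proof.
by move=> uv; rewrite !word_eval_pgen; apply/presented_eqP; apply: word_eq_rel.
Qed.

Lemma presented_lift (H : groupType) (f : X -> H) :
  (forall u v, rel u v -> word_eval f u = word_eval f v) ->
  exists! g : presented rel -> H,
    {morph g : x y / x * y} /\ (forall x, g (@pgen X rel x) = f x).
Proof.
move=> fR; pose g (x : presented rel) := word_eval f (repr x).
have gpi u : g (\pi_(presented rel) u)%qT = word_eval f u.
  by apply: (word_eval_eq fR); apply: repr_word_eq.
exists g; split; first split.
- elim/presentedW=> u; elim/presentedW=> v.
  by rewrite -[X in g X]/(pmul _ _) pmul_pi !gpi word_eval_cat.
- by move=> x; rewrite gpi /word_eval big_seq1.
move=> h [hM hgen]; apply/funext; elim/presentedW=> u.
have h1 : h 1 = 1 by apply: (mulgI (h 1)); rewrite -hM !mulg1.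
rewrite gpi -word_eval_pgen; elim: u => [|[x b] u IH].
  by rewrite /word_eval !big_nil h1.
rewrite -cat1s !word_eval_cat hM -IH; congr (_ * _).
rewrite /word_eval !big_seq1 /=; case: b; rewrite ?hgen //.
by apply: (mulgI (f x)); rewrite mulgV -hgen -hM mulgV h1.
Qed.

End UniversalProperty.

Record mgraph := MGraph {
  vertex : finType;
  edge : finType;
  ends : edge -> {set vertex};
  card_ends : forall e, #|ends e| = 2
}.

Arguments ends {m}.

Definition incident (G : mgraph) (v : vertex G) : {set edge G} :=
  [set e | v \in ends e]%SET.

Definition miso (G H : mgraph) : Prop :=
  exists (f : vertex G -> vertex H) (g : edge G -> edge H),
    [/\ bijective f, bijective g & forall e, ends (g e) = f @: ends e].

Section Operations.
Variable G : mgraph.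

Section DeleteEdge.
Variable e : edge G.

Definition del_edge_ends (e' : {e' : edge G | e' != e}) : {set vertex G} :=
  ends (val e').

Lemma card_del_edge_ends e' : #|del_edge_ends e'| = 2.
Proof. exact: card_ends. Qed.

Definition delete_edge : mgraph := MGraph card_del_edge_ends.
End DeleteEdge.

Section DeleteVertex.
Variable v : vertex G.

Definition del_vertex_ends (e : {e : edge G | v \notin ends e}) :
    {set {w : vertex G | w != v}} :=
  [set w | val w \in ends (val e)]%SET.

Lemma card_del_vertex_ends e : #|del_vertex_ends e| = 2.
Proof.
case: e => e ve; rewrite -(card_ends e) -(card_imset _ val_inj); apply: eq_card => w.
apply/imsetP/idP => [[w' + ->]|we]; first by rewrite inE.
have wv : w != v by apply: contraNneq ve => <-.
by exists (exist _ w wv); rewrite ?inE.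
Qed.

Definition delete_vertex : mgraph := MGraph card_del_vertex_ends.
End DeleteVertex.

Section ContractEdge.
Variable e : edge G.

(* [None] is the vertex obtained by merging the two ends of e. *)
Definition contract_vertex (w : vertex G) : option {w | w \notin ends e} :=
  insub w.

Definition contract_ends (e' : {e' : edge G | ends e' != ends e}) :
    {set option {w | w \notin ends e}} :=
  contract_vertex @: ends (val e').

Lemma card_contract_ends e' : #|contract_ends e'| = 2.
Proof.
rewrite -(card_ends (val e')); apply: card_in_imset => x y xe ye.
rewrite /contract_vertex; case: insubP => [u _ <-|].
  by case: insubP => [w _ <- [->]|].
rewrite negbK => xe0; case: insubP => // /negbNE ye0 _.
apply/eqP; apply: contraNT (valP e') => xy; apply/eqP.
have pairE (f : edge G) : x \in ends f -> y \in ends f -> ends f = [set x; y]%SET.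
  move=> xf yf; apply/esym/eqP; rewrite eqEcard card_ends cards2 xy andbT.
  by apply/fintype.subsetP => z; rewrite !inE => /orP[]/eqP->.
by rewrite (pairE _ xe ye) (pairE _ xe0 ye0).
Qed.

Definition contract_edge : mgraph := MGraph card_contract_ends.
End ContractEdge.

End Operations.

Inductive minor (H : mgraph) : mgraph -> Prop :=
| minor_iso G : miso H G -> minor H G
| minor_delete_edge G (e : edge G) : minor H (delete_edge e) -> minor H G
| minor_delete_vertex G (v : vertex G) : minor H (delete_vertex v) -> minor H G
| minor_contract_edge G (e : edge G) : minor H (contract_edge e) -> minor H G.

Lemma card_C2_ends (e : 'I_2) : #|[set: 'I_2]%SET| = 2.
Proof. by rewrite cardsT card_ord. Qed.

Definition C2 : mgraph := MGraph card_C2_ends.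

Section DisjointUnion.
Variables G H : mgraph.

Definition disj_ends (e : edge G + edge H) : {set vertex G + vertex H} :=
  match e with inl e => inl @: ends e | inr e => inr @: ends e end.

Lemma card_disj_ends e : #|disj_ends e| = 2.
Proof. by case: e => e /=; rewrite card_imset ?card_ends // => x y []. Qed.

Definition disj_union : mgraph := MGraph card_disj_ends.
End DisjointUnion.

Section CompleteBipartite.
Variables m n : nat.

Definition bipartite_ends (e : 'I_m * 'I_n) : {set 'I_m + 'I_n} :=
  [set inl e.1; inr e.2]%SET.

Lemma card_bipartite_ends e : #|bipartite_ends e| = 2.
Proof. by rewrite cards2. Qed.

Definition complete_bipartite : mgraph := MGraph card_bipartite_ends.
End CompleteBipartite.

Section IncidenceGroup.
Variables (G : mgraph) (b : vertex G -> 'Z_2).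

(* [Some e] is the generator x_e, [None] is the generator J. *)
Notation gword := (word (option (edge G))).
Definition wx (e : edge G) : gword := word_gen (Some e).
Definition wJ : gword := word_gen None.

(* In the last relation the product is taken in the order of [enum]; by the
   relations [inc_xx] the order of the factors does not matter. *)
Inductive incidence_rel : gword -> gword -> Prop :=
| inc_J2 : incidence_rel (wJ ++ wJ) [::]
| inc_x2 e : incidence_rel (wx e ++ wx e) [::]
| inc_xJ e : incidence_rel (word_comm (wx e) wJ) [::]
| inc_xx v e e' : e \in incident v -> e' \in incident v ->
    incidence_rel (word_comm (wx e) (wx e')) [::]
| inc_vertex v :
    incidence_rel (flatten [seq wx e | e <- enum (incident v)])
                  (flatten (nseq (b v) wJ)).

Definition incidence_group : groupType := presented incidence_rel.
End IncidenceGroup.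

(* Main.v *)
Require Import Defs.
From HB Require Import structures.
From mathcomp Require Import all_boot all_algebra.
From mathcomp Require Import boolp.
From mathcomp Require Import zify.

(** Killing the central involution J makes the colouring irrelevant, so the
    question is about "solutions": involutions x_e in a group, commuting around
    each vertex with product 1 there.  Solutions on a minor extend to the graph,
    and both C_2 + C_2 and K_{3,6} have solutions of infinite order.

    Conversely let G avoid both minors and induct on the number of edges.  An
    edge e with x_e central may be deleted, and a vertex of degree 2 may be
    suppressed.  If G minus the ends of e is a forest, then peeling off leaves
    writes every x_f as a product of elements commuting with x_e, so x_e is
    central.  What remains is a simple graph of minimum degree 3, without two
    disjoint cycles, in which every edge misses some cycle; as in Lovasz's
    theorem such a graph has 5 vertices or is K_{3,n}.  On 5 vertices everything
    commutes, by the drawing of K_5 with a single crossing.  For K_{3,n} with n <= 5 the rows a and b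
    extend to homomorphisms of F_2^5 whose values at every point commute, and
    two elementary abelian 2-groups in this position generate a finite group. *)

Set Implicit Arguments.
Unset Strict Implicit.
Unset Printing Implicit Defensive.

(** * Simple graphs without two disjoint cycles *)

(** Lovasz's list also contains the wheels, [K_{3,n}] with edges added among its three vertices, and
    graphs with a vertex lying on every cycle. Each of these has an edge whose two ends meet every
    cycle: a spoke, an added edge, an edge at that vertex. This is why centrality of such edges is
    used before the classification, which then shrinks to two outcomes. It needs no theory of paths:
    a cycle enters only as a vertex set inducing minimum degree at least 2, and the recurring move
    is to remove a cycle and look for low-degree vertices in the forest left over.

    Finiteness is never stated for a subgroup. It is the existence of a finite list containing 1 and
    stable under right multiplication by the given elements, for all solutions in all groups at
    once; minors and reductions then only have to exhibit solutions. *)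

Section SimpleGraph.
Variables (V : finType) (adj : rel V).
Hypothesis adjC : symmetric adj.
Hypothesis adjI : irreflexive adj.

Definition deg (S : {set V}) (v : V) : nat := #|[set w in S | adj v w]|.

(* Minimal cores are the vertex sets of chordless cycles. *)
Definition core (S : {set V}) : Prop :=
  S != set0 /\ forall v, v \in S -> 1 < deg S v.

Definition core_free (F : {set V}) : Prop :=
  forall S : {set V}, S \subset F -> ~ core S.

Lemma deg_sub (S T : {set V}) v : S \subset T -> deg S v <= deg T v.
Proof.
move=> ST; apply: subset_leq_card; apply/subsetP => w; rewrite !inE => /andP[wS ->].
by rewrite (subsetP ST).
Qed.

Lemma degD (A B : {set V}) v : [disjoint A & B] -> deg (A :|: B) v = deg A v + deg B v.
Proof.
move=> dAB; rewrite /deg -cardsUI.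
have -> : [set w in A | adj v w] :&: [set w in B | adj v w] = set0.
  apply/setP => w; rewrite !inE; apply/negbTE/negP => /andP[/andP[wA _] /andP[wB _]].
  by have := disjointFr dAB wA; rewrite wB.
by rewrite cards0 addn0; congr #|pred_of_set _|; apply/setP => w; rewrite !inE andb_orl.
Qed.

Lemma deg1 w v : deg [set w] v = adj v w.
Proof.
rewrite /deg; case vw: (adj v w).
  have -> : [set x in [set w] | adj v x] = [set w].
    by apply/setP => x; rewrite !inE; case: eqP => // ->.
  by rewrite cards1.
apply/eqP; rewrite cards_eq0; apply/eqP/setP => x; rewrite !inE.
by case: eqP => // ->; rewrite vw.
Qed.

Lemma degU1 w (S : {set V}) v : w \notin S -> deg (w |: S) v = adj v w + deg S v.
Proof. by move=> wS; rewrite degD ?deg1 // disjoints1. Qed.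

Lemma degD1 w (S : {set V}) v : w \in S -> deg S v = adj v w + deg (S :\ w) v.
Proof. by move=> wS; rewrite -{1}(setD1K wS) degU1 // !inE eqxx. Qed.

Lemma deg_gt0P (S : {set V}) v : reflect (exists2 w, w \in S & adj v w) (0 < deg S v).
Proof.
apply: (iffP card_gt0P) => [[w]|[w wS vw]]; first by rewrite inE => /andP[]; exists w.
by exists w; rewrite inE wS.
Qed.

Lemma deg_gt1P (S : {set V}) v :
  reflect (exists x y, [/\ x \in S, y \in S, x != y, adj v x & adj v y]) (1 < deg S v).
Proof.
apply: (iffP card_gt1P) => [[x [y []]]|[x [y [xS yS xy vx vy]]]].
  by rewrite !inE => /andP[xS vx] /andP[yS vy] xy; exists x, y.
by exists x, y; rewrite !inE xS yS.
Qed.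

Lemma deg_le1_uniq (S : {set V}) v x y :
  deg S v <= 1 -> x \in S -> y \in S -> adj v x -> adj v y -> x = y.
Proof.
move=> d1 xS yS vx vy; apply/eqP; apply: contraLR d1 => xy; rewrite -ltnNge.
by apply/deg_gt1P; exists x, y.
Qed.

Lemma core_freeS (E F : {set V}) : E \subset F -> core_free F -> core_free E.
Proof. by move=> EF cF S SE; apply/cF/(subset_trans SE). Qed.

Lemma core_free_leaf (F : {set V}) :
  core_free F -> F != set0 -> exists2 l, l \in F & deg F l <= 1.
Proof.
move=> cF F0; have [/existsP[l /andP[lF dl]]|] := boolP [exists l in F, deg F l <= 1].
  by exists l.
rewrite negb_exists => /forallP h; case: (cF F) => //; split=> // v vF.
by have := h v; rewrite vF /= -ltnNge.
Qed.

(** When [r] has degree at least 2 any leaf will do. Otherwise [r] is removed and the rest is rooted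
    at its neighbour [s], if there is one: a leaf other than [s] is not adjacent to [r], so its
    degree is unchanged. In the applications the forest is disjoint from a chosen cycle and [r] is a
    vertex put into it on purpose. *)
Lemma core_free_leaf_neq (F : {set V}) r :
  core_free F -> r \in F -> F != [set r] ->
  exists m, [/\ m \in F, m != r & deg F m <= 1].
Proof.
elim: {F}_.+1 {-2}F r (ltnSn #|F|) => // n IHn F r Fn cF rF Fr.
have F'0 : F :\ r != set0.
  by apply: contraNneq Fr => e; rewrite -(setD1K rF) e setU0.
have cF' : core_free (F :\ r) by apply: core_freeS cF; apply: subD1set.
have [d2|] := ltnP 1 (deg F r).
  have F0 : F != set0 by apply/set0Pn; exists r.
  have [m mF dm] := core_free_leaf cF F0.
  by exists m; split=> //; apply: contraTneq dm => ->; rewrite -ltnNge.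
case: (posnP (deg F r)) => [d0 _|/deg_gt0P[s sF rs] d1].
  have [m mF dm] := core_free_leaf cF' F'0; have := mF; rewrite !inE => /andP[mr mF1].
  exists m; split=> //; rewrite (degD1 m rF).
  have -> : adj m r = false; last by [].
  apply/negbTE/negP => mr'.
  by have : 0 < deg F r by [apply/deg_gt0P; exists m; rewrite // adjC]; rewrite d0.
have sF' : s \in F :\ r.
  by rewrite !inE sF andbT; apply: contraTneq rs => ->; rewrite adjI.
have [Fs|Fs] := eqVneq (F :\ r) [set s].
  exists s; move: (sF'); rewrite !inE => /andP[sr _]; split=> //.
  by rewrite (degD1 s rF) Fs deg1 adjI; case: adj.
have [|m [mF ms dm]] := IHn (F :\ r) s _ cF' sF' Fs.
  by have := cardsD1 r F; rewrite rF; lia.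
have := mF; rewrite !inE => /andP[mr mF1]; exists m; split=> //.
rewrite (degD1 m rF); have -> : adj m r = false; last by [].
apply: contraNF ms => mr'; apply/eqP.
by apply: (deg_le1_uniq d1) => //; rewrite adjC.
Qed.

Definition deg_sum (S : {set V}) := \sum_(v in S) deg S v.

Lemma deg_sumD1 (S : {set V}) l :
  l \in S -> deg_sum S = deg_sum (S :\ l) + (deg S l).*2.
Proof.
move=> lS; rewrite /deg_sum (big_setD1 l) //= addnC -addnn addnA; congr (_ + _).
rewrite (eq_bigr (fun v => adj v l + deg (S :\ l) v)) => [|v _]; last exact: degD1.
rewrite big_split addnC /=; congr (_ + _).
rewrite (degD1 l lS) adjI add0n (eq_bigr (fun v => if adj v l then 1 else 0)).
  rewrite -big_mkcondr sum1_card; apply: eq_card => v.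
  by rewrite unfold_in /= !inE adjC.
by move=> v _; case: adj.
Qed.

(** Removing a leaf loses at most one edge. As [deg_sum] counts every edge twice, this is the bound
    [#|F| - 1] on the number of edges of a forest. *)
Lemma deg_sum_core_free (F : {set V}) :
  core_free F -> F != set0 -> deg_sum F + 2 <= #|F|.*2.
Proof.
elim: {F}_.+1 {-2}F (ltnSn #|F|) => // n IHn F Fn cF F0.
have [l lF dl] := core_free_leaf cF F0.
have cF' : core_free (F :\ l) by apply: core_freeS cF; apply: subD1set.
have cE := cardsD1 l F; rewrite lF in cE; rewrite (deg_sumD1 lF).
have [F'0|F'0] := eqVneq (F :\ l) set0.
  move: cE; rewrite F'0 cards0 /deg_sum big_set0 (degD1 l lF) F'0 adjI => ->.
  by rewrite /deg (_ : [set w in set0 | adj l w] = set0) ?cards0 //; apply/setP => w; rewrite !inE.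
have := IHn _ _ cF' F'0; lia.
Qed.

Lemma core3 u v w : adj u v -> adj v w -> adj u w -> core [set u; v; w].
Proof.
move=> uv vw uw.
have neq x y : adj x y -> x != y by move=> xy; apply: contraTneq xy => ->; rewrite adjI.
split; first by apply/set0Pn; exists u; rewrite !inE eqxx.
move=> x; rewrite !inE -orbA => /or3P[]/eqP->; apply/deg_gt1P.
- by exists v, w; rewrite !inE !eqxx ?orbT uv uw neq.
- by exists u, w; rewrite !inE !eqxx ?orbT vw adjC uv neq.
- by exists u, v; rewrite !inE !eqxx ?orbT adjC uw adjC vw neq.
Qed.

Lemma core4 a b c d : adj a b -> adj b c -> adj c d -> adj d a ->
  a != c -> b != d -> core [set a; b; c; d].
Proof.
move=> ab bc cd da ac bd.
split; first by apply/set0Pn; exists a; rewrite !inE eqxx.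
move=> x; rewrite !inE -!orbA => /or4P[]/eqP->; apply/deg_gt1P.
- by exists b, d; rewrite !inE !eqxx ?orbT ab adjC da.
- by exists a, c; rewrite !inE !eqxx ?orbT bc adjC ab.
- by exists b, d; rewrite !inE !eqxx ?orbT cd adjC bc.
- by exists a, c; rewrite !inE !eqxx ?orbT da adjC cd.
Qed.

(** * Graphs of minimum degree 3 in which any two cycles meet *)

Hypothesis no_disjoint_cores : forall S T : {set V},
  core S -> core T -> exists2 x, x \in S & x \in T.

Lemma core_free_compl (S F : {set V}) : core S -> [disjoint S & F] -> core_free F.
Proof.
move=> cS dSF T TF cT; have [x xS xT] := no_disjoint_cores cS cT.
by have := disjointFr dSF xS; rewrite (subsetP TF).
Qed.

(** Isolated vertices may be present, so minimum degree 3 can only be asked of the vertices that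
    carry an edge; by [adj_big] these are exactly the vertices of [W]. *)
Definition big_vertices : {set V} := [set v | 2 < deg setT v].
Local Notation W := big_vertices.
Hypothesis adj_big : forall u v, adj u v -> u \in W.

Lemma deg_big v : deg W v = deg setT v.
Proof.
apply: eq_card => w; rewrite !inE; case vw: (adj v w); rewrite ?andbF //.
by have := adj_big (etrans (adjC w v) vw); rewrite inE => ->.
Qed.

Lemma big_deg v : v \in W -> 2 < deg W v.
Proof. by rewrite deg_big inE. Qed.

Lemma core_big S : core S -> S \subset W.
Proof.
move=> [_ cS]; apply/subsetP => v /cS/ltnW/deg_gt0P[w _]; exact: adj_big.
Qed.

Lemma deg_split (T : {set V}) v : T \subset W -> deg W v = deg T v + deg (W :\: T) v.
Proof.
move=> TW; rewrite -{1}(setID W T) (setIidPr TW) degD //.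
by rewrite -setI_eq0; apply/eqP/setP => x; rewrite !inE; case: (x \in T).
Qed.

Lemma neq_adj x y : adj x y -> x != y.
Proof. by move=> xy; apply: contraTneq xy => ->; rewrite adjI. Qed.

Lemma deg3 x y z v : x != y -> x != z -> y != z ->
  deg [set x; y; z] v = adj v x + adj v y + adj v z.
Proof.
move=> xy xz yz; rewrite setUC degU1 ?(setUC [set x]) ?degU1 ?deg1; first lia.
  by rewrite inE eq_sym.
by rewrite !inE negb_or ![z == _]eq_sym yz xz.
Qed.

Lemma deg4 x y z w v : x != y -> x != z -> y != z -> w \notin [set x; y; z] ->
  deg [set x; y; z; w] v = adj v x + adj v y + adj v z + adj v w.
Proof. by move=> xy xz yz wS; rewrite setUC degU1 // deg3 // addnC. Qed.

Hypothesis edge_core : forall u v, adj u v ->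
  exists S, [/\ core S, u \notin S & v \notin S].

(** Let [F] be the forest outside the triangle [T]. A leaf [l] of [F] turns out to be adjacent to
    all of [T], and so does its only neighbour [m] in [F]. Then [l] and [m] form a component of [F],
    and a further component would give two disjoint triangles. *)
Lemma triangle_order5 x0 y0 z0 : adj x0 y0 -> adj y0 z0 -> adj x0 z0 ->
  #|W| = 5.
Proof.
move=> x0y0 y0z0 x0z0.
have [T [cT cardT adjT]] : exists T : {set V}, [/\ core T, #|T| = 3
    & {in T &, forall x y, x != y -> adj x y}].
  exists [set x0; y0; z0]; split; first exact: core3.
    rewrite -setUA cardsU1 cards2 !inE negb_or.
    by rewrite neq_adj // neq_adj // neq_adj.
  move=> x y; rewrite !inE -!orbA => /or3P[]/eqP-> /or3P[]/eqP->;
  by rewrite ?eqxx // => _; rewrite // adjC.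
have TW : T \subset W by apply: core_big.
have [F FE] : exists F, F = W :\: T by exists (W :\: T).
have inF x : (x \in F) = (x \notin T) && (x \in W) by rewrite FE in_setD.
have dTF : [disjoint T & F].
  rewrite -setI_eq0; apply/eqP/setP => x; rewrite in_set0 in_setI inF.
  by case: (x \in T).
have cF : core_free F by apply: core_free_compl cT dTF.
have third x y : x \in T -> y \in T -> x != y ->
    exists z, [/\ T = [set x; y; z], z \in T, z != x & z != y].
  move=> xT yT xy.
  have yT' : y \in T :\ x by rewrite in_setD1 eq_sym xy.
  have : #|T :\ x :\ y| == 1.
    have := cardsD1 x T; have := cardsD1 y (T :\ x); rewrite xT yT' cardT.
    by move=> e1 e2; apply/eqP; move: e1 e2; rewrite /=; clear; lia.
  move=> /cards1P[z zE]; have : z \in T :\ x :\ y by rewrite zE set11.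
  rewrite !in_setD1 => /and3P[zy zx zT]; exists z; split=> //.
  by rewrite -(setD1K xT) -(setD1K yT') zE setUA.
have degF x : x \in F -> 2 < deg T x + deg F x.
  by rewrite inF => /andP[_ /big_deg]; rewrite (deg_split x TW) -FE.
(* A cycle missing both [x] and [y] must still meet [T], hence passes through [z] and otherwise
   stays in [F]. *)
have avoid x y z : T = [set x; y; z] -> x \in T -> y \in T -> x != y ->
    exists S, [/\ core S, z \in S & S \subset z |: F].
  move=> TE xT yT xy.
  have [S [cS xS yS]] := edge_core (adjT _ _ xT yT xy).
  have Tz s : s \in S -> s \in T -> s = z.
    move=> sS; rewrite TE !inE => /orP[/orP[]|] /eqP sE //; move: xS yS;
    by rewrite -sE sS.
  have SF : S \subset z |: F.
    apply/subsetP => s sS; rewrite in_setU1 inF (subsetP (core_big cS) _ sS) andbT.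
    by have [/(Tz _ sS)-> |] := boolP (s \in T); rewrite ?eqxx ?orbT.
  exists S; split=> //; have [s sS sT] := no_disjoint_cores cS cT.
  by rewrite -(Tz s).
have zF z : z \in T -> z \notin F by rewrite inF => ->.
(* Having degree at least 3, [l] sees two vertices [x], [y] of [T]. The triangle on [l], [x], [y]
   can meet the cycle through the third vertex [z] only in [l], so [l] has two neighbours in
   [z |: F]. *)
have leafF l : l \in F -> deg F l <= 1 -> deg F l = 1 /\ forall z, z \in T -> adj l z.
  move=> lF dl.
  have /deg_gt1P[x [y [xT yT xy lx ly]]] : 1 < deg T l by move: dl (degF l lF); clear; lia.
  have [z [TE zT zx zy]] := third x y xT yT xy.
  have [S [cS zS SF]] := avoid x y z TE xT yT xy.
  have lS : l \in S.
    have [s sl sS] := no_disjoint_cores (core3 lx (adjT _ _ xT yT xy) ly) cS.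
    have := subsetP SF _ sS; rewrite in_setU1 => /orP sF.
    move: sl; rewrite !inE -orbA => /or3P[]/eqP sE; subst s => //.
    - by case: sF => [/eqP xz|xF]; [rewrite xz eqxx in zx|have := zF x xT; rewrite xF].
    - by case: sF => [/eqP xz|xF]; [rewrite xz eqxx in zy|have := zF y yT; rewrite xF].
  have := (cS.2) l lS; move/leq_trans/(_ (deg_sub l SF)); rewrite degU1 ?zF // => dS.
  have lz : adj l z by move: dS dl; case: (adj l z) => //=; clear; lia.
  split; first by move: dS dl; rewrite lz; clear; lia.
  by move=> t; rewrite TE !inE -orbA => /or3P[]/eqP->.
have [x [y [z [[TE xT yT zT] [xy xz yz]]]]] : exists x y z,
    [/\ T = [set x; y; z], x \in T, y \in T & z \in T] /\ [/\ x != y, x != z & y != z].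
  have /card_gt1P[x [y [xT yT xy]]] : 1 < #|T| by rewrite cardT.
  have [z [TE zT zx zy]] := third x y xT yT xy.
  by exists x, y, z; rewrite xy eq_sym zx eq_sym zy.
have F0 : F != set0.
  have [S [cS zS SF]] := avoid x y z TE xT yT xy.
  have /deg_gt0P[s sS zs] : 0 < deg S z by apply/ltnW/cS.2.
  have := subsetP SF _ sS; rewrite in_setU1 => /orP[/eqP sz|sF].
    by rewrite sz adjI in zs.
  by apply/set0Pn; exists s.
have [l lF dl] := core_free_leaf cF F0; have [dl1 lT] := leafF l lF dl.
have /deg_gt0P[m mF lm] : 0 < deg F l by rewrite dl1.
have ml : m != l by rewrite eq_sym neq_adj.
have uniq_l w : w \in F -> adj l w -> w = m.
  by move=> wF lw; apply: (deg_le1_uniq dl).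
(* The triangle on [l] and the two vertices of [T] other than [t] leaves a forest containing [t].
   Every vertex of [F] not adjacent to [l] keeps degree at least 2 there, so its low-degree vertex
   other than [t] is [m]. *)
have rooted t : t \in T -> deg F m <= 1 \/ deg F m = 2 /\ ~~ adj m t.
  move=> tT; have [p [q [pT qT pq TpE]]] : exists p q,
      [/\ p \in T, q \in T, p != q & t \notin [set p; q]].
    move: tT; rewrite {1}TE !inE -orbA => /or3P[]/eqP->.
    - by exists y, z; split=> //; rewrite !inE negb_or xy.
    - by exists x, z; split=> //; rewrite !inE negb_or [y == x]eq_sym xy.
    - by exists x, y; split=> //; rewrite !inE negb_or ![z == _]eq_sym xz.
  have cX : core_free (t |: F :\ l).
    apply: core_free_compl (core3 (lT p pT) (adjT _ _ pT qT pq) (lT q qT)) _.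
    rewrite -setI_eq0; apply/eqP/setP => s; rewrite in_set0 in_setI in_setU1 in_setD1.
    apply/negbTE/negP; rewrite !inE -orbA => /andP[/or3P[]/eqP->].
    - by rewrite eqxx orbF => /eqP lt; have := zF t tT; rewrite -lt lF.
    - rewrite inF pT andbF orbF => /eqP pt; move: TpE; rewrite !inE -pt eqxx //.
    - rewrite inF qT andbF orbF => /eqP pt; move: TpE; rewrite !inE -pt eqxx orbT //.
  have mX : m \in t |: F :\ l by rewrite in_setU1 in_setD1 ml mF orbT.
  have Xt : t |: F :\ l != [set t].
    apply: contraTneq mX => ->; rewrite in_set1; apply: contraTneq mF => ->.
    exact: zF.
  have [w [wX wt dw]] := core_free_leaf_neq cX (setU11 _ _) Xt.
  move: wX; rewrite in_setU1 (negbTE wt) in_setD1 => /andP[wl wF].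
  have tX : t \notin F :\ l by rewrite in_setD1 (negbTE (zF t tT)) andbF.
  move: dw; rewrite degU1 // => dw; have := degD1 w lF => dwF.
  have wm : adj w l -> w = m by move=> wl'; apply: uniq_l => //; rewrite adjC.
  have [dw1|dw2] := leqP (deg F w) 1.
    have [dwE wT] := leafF w wF dw1; rewrite (wT t tT) in dw.
    by left; rewrite -wm //; move: dw dwF; rewrite dwE; case: (adj w l) => //=; clear; lia.
  have wl' : adj w l by move: dw dwF dw2; case: (adj w l) => //=; clear; lia.
  rewrite -wm //; right; move: dw dwF dw2; rewrite wl'; case: (adj w t) => /=; clear; lia.
(* If the second alternative held for all three vertices of [T], the total degree of [m] would be
   2. *)
have dm : deg F m <= 1.
  have [//|[d2 mx]] := rooted x xT; have [//|[_ my]] := rooted y yT.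
  have [//|[_ mz]] := rooted z zT; have := degF m mF.
  by rewrite d2 TE deg3 // (negbTE mx) (negbTE my) (negbTE mz).
have [dm1 mT] := leafF m mF dm.
have uniq_m w : w \in F -> adj m w -> w = l.
  by move=> wF mw; apply: (deg_le1_uniq dm) => //; rewrite adjC.
have FE2 : F = [set l; m].
  apply/eqP; rewrite eq_sym eqEsubset; apply/andP; split.
    by apply/subsetP => w; rewrite !inE => /orP[]/eqP->.
  rewrite -setD_eq0 -[_ == _]negbK; apply/negP => F2.
  have [|w wF2 dw] := core_free_leaf _ F2.
    by apply: core_freeS cF; apply: subsetDl.
  have := wF2; rewrite in_setD in_set2 negb_or => /andP[/andP[wl wm] wF].
  have wl' : adj w l = false.
    by apply: contraNF wm => wl'; apply/eqP/uniq_l; rewrite // adjC.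
  have wm' : adj w m = false.
    by apply: contraNF wl => wm'; apply/eqP/uniq_m; rewrite // adjC.
  have dwF : deg F w <= 1.
    rewrite (degD1 w lF) wl' (degD1 (w := m)) ?wm' ?in_setD1 ?ml //.
    rewrite (_ : F :\ l :\ m = F :\: [set l; m]) //.
    by apply/setP => s; rewrite !in_setD1 in_setD in_set2 negb_or andbA [(s != m) && _]andbC.
  have [_ wT] := leafF w wF dwF.
  have [s] := no_disjoint_cores (core3 (wT x xT) (adjT _ _ xT yT xy) (wT y yT))
    (core3 lm (mT z zT) (lT z zT)).
  have nF t t' : t \in T -> t' \in F -> (t == t') = false.
    by move=> tT tF; apply: contraTF tF => /eqP <-; apply: zF.
  have wz : (w == z) = false by rewrite eq_sym nF.
  rewrite !inE -!orbA => /or3P[]/eqP-> /or3P[];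
  by rewrite ?(negbTE wl) ?(negbTE wm) ?(negbTE xz) ?(negbTE yz) ?wz ?nF.
have WE : W = T :|: [set l; m].
  by rewrite -FE2 FE -{1}(setIidPr TW) setID.
have dis : [disjoint T & [set l; m]] by rewrite -FE2.
by rewrite WE cardsU cardT cards2 eq_sym ml (disjoint_setI0 dis) cards0.
Qed.

(** * Triangle-free graphs: a four-cycle and the forest outside it *)

Definition triangle_free : Prop :=
  forall x y z, adj x y -> adj y z -> adj x z -> False.

Lemma min_core : W != set0 -> exists2 S : {set V}, core S
  & forall T, core T -> #|S| <= #|T|.
Proof.
move=> W0; have cW : core W by split=> // v /big_deg/ltnW.
have [n Wn] := ubnP #|W|; move: Wn cW; move: W => S.
elim: n S => // n IHn S Sn cS.
have [[T cT TS]|min] := pselect (exists2 T, core T & #|T| < #|S|).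
  by apply: (IHn T) => //; apply: leq_trans TS _.
by exists S => // T cT; rewrite leqNgt; apply/negP => TS; apply: min; exists T.
Qed.

(** Dropping any vertex leaves a forest. The edge bound for that forest, taken at a vertex of degree
    at most 2, caps the degree sum of [S] at [#|S|.*2], which minimum degree 2 already reaches. *)
Lemma min_core_regular (S : {set V}) : core S -> (forall T, core T -> #|S| <= #|T|) ->
  {in S, forall v, deg S v = 2} /\ deg_sum S = #|S|.*2.
Proof.
move=> cS min.
have cS' p : p \in S -> core_free (S :\ p).
  move=> pS T TS cT; have := min T cT; have := subset_leq_card TS.
  by have := cardsD1 p S; rewrite pS; clear; lia.
have [p pS] := set0Pn _ cS.1.
have nz v : v \in S -> S :\ v != set0.
  move=> vS; have /deg_gt0P[w wS vw] : 0 < deg S v by apply/ltnW/cS.2.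
  by apply/set0Pn; exists w; rewrite in_setD1 wS eq_sym neq_adj.
have [r] := core_free_leaf (cS' p pS) (nz p pS); rewrite in_setD1 => /andP[_ rS] dr.
have dr2 : deg S r <= 2.
  by rewrite (degD1 r pS); move: dr; clear; case: (adj r p); lia.
have le : deg_sum S <= #|S|.*2.
  have := deg_sum_core_free (cS' r rS) (nz r rS); have := cardsD1 r S; rewrite rS.
  by rewrite (deg_sumD1 rS); move: dr2; clear; lia.
have ge : #|S|.*2 <= \sum_(v in S) 2 by rewrite sum_nat_const; clear; lia.
have sumE : \sum_(v in S) 2 = deg_sum S.
  apply/eqP; rewrite eqn_leq (leq_trans le ge) andbT.
  by apply: leq_sum => v vS; apply: cS.2.
split; last by apply/eqP; rewrite eqn_leq le -sumE ge.
move=> v vS; apply/eqP; rewrite eqn_leq cS.2 // andbT.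
have := sumE; rewrite /deg_sum !(big_setD1 v vS) /=.
have : \sum_(i in S :\ v) 2 <= \sum_(i in S :\ v) deg S i.
  by apply: leq_sum => i; rewrite in_setD1 => /andP[_ iS]; apply: cS.2.
by clear; lia.
Qed.

(** Take a shortest cycle [S] and a leaf [l] of the forest outside it, with neighbours [p], [q] on
    [S], and walk along [S] from [p] two steps to [r] and [s]. Either [s] is [q] and [l p r q] is a
    four-cycle, or exchanging [r], [s] for [l] gives a smaller set with too many edges for a
    forest. *)
Lemma four_cycle : triangle_free -> W != set0 -> exists a b c d,
  [/\ adj a b, adj b c, adj c d & adj d a] /\ a != c /\ b != d.
Proof.
move=> notri W0; have [S cS min] := min_core W0.
have [dS sumS] := min_core_regular cS min.
have SW := core_big cS.
have cF : core_free (W :\: S).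
  apply: core_free_compl cS _; rewrite -setI_eq0; apply/eqP/setP => x.
  by rewrite in_set0 in_setI in_setD; case: (x \in S).
have F0 : W :\: S != set0.
  have [p pS] := set0Pn _ cS.1; have := big_deg (subsetP SW p pS).
  rewrite (deg_split p SW) dS // => dp; have /deg_gt0P[w wF _] : 0 < deg (W :\: S) p.
    by move: dp; clear; lia.
  by apply/set0Pn; exists w.
have [l lF dl] := core_free_leaf cF F0.
have := lF; rewrite in_setD => /andP[lS lW].
have /deg_gt1P[p [q [pS qS pq lp lq]]] : 1 < deg S l.
  by have := big_deg lW; rewrite (deg_split l SW); move: dl; clear; lia.
have /deg_gt0P[r rS pr] : 0 < deg S p by rewrite dS.
have rq : r != q.
  by apply/eqP => rq; case: (notri l p q); rewrite // -rq.
have [s [sS rs sp]] : exists s, [/\ s \in S, adj r s & s != p].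
  have /deg_gt1P[x [y [xS yS xy rx ry]]] : 1 < deg S r by rewrite dS.
  have [xp|] := eqVneq x p; last by exists x.
  by exists y; split; rewrite // -xp eq_sym.
have [sq|sq] := eqVneq s q.
  exists l, p, r, q; split; last by split=> //; apply: contraNneq lS => ->.
  by split; rewrite // adjC // -sq adjC.
pose Y := S :\ r :\ s; pose X := l |: Y.
have sr : s \in S :\ r by rewrite in_setD1 eq_sym neq_adj.
have lY : l \notin Y by rewrite /Y !in_setD1 (negbTE lS) !andbF.
have pY : p \in Y by rewrite /Y !in_setD1 pS eq_sym sp neq_adj.
have qY : q \in Y by rewrite /Y !in_setD1 qS eq_sym sq eq_sym rq.
have cardY : #|Y| + 2 = #|S|.
  have := cardsD1 r S; have := cardsD1 s (S :\ r); rewrite rS sr -/Y.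
  by clear; lia.
have cX : core_free X.
  move=> T TX cT; have := min T cT; have := subset_leq_card TX.
  by rewrite cardsU1 lY; move: cardY; clear; lia.
(* [X] has one vertex less than [S]. Its degree sum is at least [#|S|.*2 - 6 + 4], against the bound
   [#|S|.*2 - 4] for a forest of that size. *)
have := deg_sum_core_free cX; rewrite cardsU1 lY.
have -> : X != set0 by apply/set0Pn; exists l; apply: setU11.
move=> /(_ isT); rewrite (deg_sumD1 (setU11 _ _)) setU1K //.
have : 1 < deg X l.
  apply/deg_gt1P; exists p, q; rewrite !in_setU1 pY qY !orbT; split=> //.
have := deg_sumD1 rS; have := deg_sumD1 sr; rewrite -/Y dS // sumS.
have : deg (S :\ r) s = 1.
  by have := degD1 s rS; rewrite dS // adjC rs; clear; lia.
move=> ->; rewrite -/X; move: cardY => c1 c2 c3 c4 c5; exfalso; move: c1 c2 c3 c4 c5; clear; lia.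
Qed.

Definition is_K3n : Prop := exists x y z, let P := [set x; y; z] in
  [/\ x != y, x != z & y != z] /\
  [/\ {in P &, forall u v, adj u v = false},
      {in W :\: P &, forall u v, adj u v = false}
    & {in W :\: P & P, forall u v, adj u v}].

Section FourCycle.
Hypothesis notri : triangle_free.
Variables a b c d : V.
Hypotheses (ab : adj a b) (bc : adj b c) (cd : adj c d) (da : adj d a).
Hypotheses (ac : a != c) (bd : b != d).

Definition off_cycle : {set V} := W :\: [set a; b; c; d].
Local Notation F := off_cycle.

Lemma in_off_cycle x :
  (x \in F) = [&& x != a, x != b, x != c, x != d & x \in W].
Proof. by rewrite in_setD !in_setU !in_set1 !negb_or -!andbA. Qed.

Lemma no_triangle x y z : adj x y -> adj y z -> adj x z = false.
Proof. by move=> xy yz; apply/negP; apply: notri xy yz. Qed.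

Lemma cycle_big : [/\ a \in W, b \in W, c \in W & d \in W].
Proof. by split; apply: adj_big; eassumption. Qed.

Lemma disjoint_off_cycle (S A : {set V}) :
  (forall x, x \in S -> x \notin A) -> [disjoint S & A].
Proof.
move=> SA; rewrite -setI_eq0; apply/eqP/setP => x; rewrite in_set0 in_setI.
by apply/negP => /andP[/SA/negP].
Qed.

Lemma core_free_off_cycle : core_free F.
Proof.
apply: core_free_compl (core4 ab bc cd da ac bd) _; apply: disjoint_off_cycle => x.
by rewrite in_setD negb_and negbK => ->.
Qed.

Lemma deg_off_cycle x :
  deg W x = adj x a + adj x b + adj x c + adj x d + deg F x.
Proof.
have [aW bW cW dW] := cycle_big.
have dC : d \notin [set a; b; c].
  by rewrite !in_setU !in_set1 !negb_or neq_adj // [d == b]eq_sym bd eq_sym neq_adj.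
have CW : [set a; b; c; d] \subset W.
  by apply/subsetP => y; rewrite !in_setU !in_set1 => /orP[/orP[/orP[]|]|] /eqP->.
by rewrite (deg_split x CW) deg4 // ?(neq_adj ab) ?(neq_adj bc).
Qed.

(** Without triangles [l] cannot see two consecutive vertices of the cycle, so it sees at most two,
    and these are opposite. Degree 3 forces both of them and one neighbour in [F]. *)
Lemma off_cycle_leaf l : l \in F -> deg F l <= 1 ->
  deg F l = 1 /\ ((adj l a && adj l c) || (adj l b && adj l d)).
Proof.
rewrite in_off_cycle => /and5P[_ _ _ _ /big_deg]; rewrite deg_off_cycle.
have := @no_triangle l a b; have := @no_triangle l b c.
have := @no_triangle l c d; have := @no_triangle l d a; rewrite ab bc cd da.
case: (adj l a); case: (adj l b); case: (adj l c); case: (adj l d) => /=;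
by move=> h1 h2 h3 h4; first [discriminate (h1 isT isT)|discriminate (h2 isT isT)
 |discriminate (h3 isT isT)|discriminate (h4 isT isT)|split=> //; lia|lia].
Qed.

Lemma off_cycle_deg_gt0 x : x \in F -> 0 < deg F x.
Proof.
move=> xF; have [/ltnW //|d1] := ltnP 1 (deg F x).
by have [-> _] := off_cycle_leaf xF d1.
Qed.

(* The case of K_{3,3}: {a, c, m} against {b, d, m'}. *)
Lemma one_leaf_K3n m : m \in F -> adj m b -> adj m d ->
  deg F m <= 1 ->
  (forall x, x \in F -> deg F x <= 1 -> x != m -> adj x a /\ adj x c) -> is_K3n.
Proof.
move=> mF mb md dm leaves; have cF := core_free_off_cycle.
have [dm1 _] := off_cycle_leaf mF dm.
have /deg_gt0P[m' m'F mm'] : 0 < deg F m by rewrite dm1.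
have m'm : m' != m by rewrite eq_sym neq_adj.
have uniq_m w : w \in F -> adj m w -> w = m' by move=> wF mw; apply: (deg_le1_uniq dm).
have := mF; rewrite in_off_cycle => /and5P[ma mb' mc md' mW].
have cyc y : adj b y -> adj y d -> y \notin F -> m != y -> core [set m; b; y; d].
  by move=> by' yd yF my; apply: core4 => //; rewrite adjC.
(* The four-cycle on [m], [b], [y], [d] leaves the forest [y' |: F :\ m]. A low-degree vertex of it
   other than [y'] must have lost the neighbour [m], so it is [m']. Used with [a] and with [c] in
   the role of [y']. *)
have rooted y y' : adj b y -> adj y d -> y \notin F -> m != y -> y' \notin F -> m != y' ->
    y' \notin [set b; y; d] -> (forall x, x \in F -> deg F x <= 1 -> x != m -> adj x y') ->
    deg F m' <= 1 \/ deg F m' = 2 /\ ~~ adj m' y'.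
  move=> by' yd yF my y'F my' y'C lv; pose X := y' |: F :\ m.
  have cX : core_free X.
    apply: core_free_compl (cyc y by' yd yF my) _; apply: disjoint_off_cycle => x.
    rewrite in_setU1 in_setD1; have [->|xm] := eqVneq x m; first by rewrite orbF => _.
    rewrite !in_setU !in_set1 (negbTE xm) /= => xC; rewrite negb_or; apply/andP; split.
      by apply: contraNneq y'C => <-; rewrite !in_setU !in_set1.
    by case/orP: xC => [/orP[]|] /eqP-> //; rewrite in_off_cycle eqxx ?andbF.
  have m'X : m' \in F :\ m by rewrite in_setD1 m'm.
  have Xy : X != [set y'].
    apply: contraTneq m'F => /setP/(_ m'); rewrite in_setU1 m'X orbT in_set1 => /esym/eqP->.
    exact: y'F.
  have [w [wX wy' dw]] := core_free_leaf_neq cX (setU11 _ _) Xy.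
  move: wX; rewrite in_setU1 (negbTE wy') in_setD1 => /andP[wm wF].
  have y'X : y' \notin F :\ m by rewrite in_setD1 (negbTE y'F) andbF.
  move: dw; rewrite degU1 // => dw; have dwF := degD1 w mF.
  have wE : adj w m -> w = m' by move=> wm'; apply: uniq_m => //; rewrite adjC.
  have [dw1|dw2] := leqP (deg F w) 1.
    have [dwE _] := off_cycle_leaf wF dw1; rewrite (lv w) // in dw.
    left; rewrite -wE //; move: dw dwF; rewrite dwE; clear; case: (adj w m) => //=; lia.
  have wm' : adj w m by move: dw dwF dw2; clear; case: (adj w m) => //=; lia.
  rewrite -wE //; right; move: dw dwF dw2; rewrite wm'; clear; case: (adj w y') => /=; lia.
have aF : a \notin F by rewrite in_off_cycle eqxx.
have cFn : c \notin F by rewrite in_off_cycle eqxx !andbF.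
have nm'b : adj m' b = false by rewrite adjC (no_triangle (y := m)) // adjC.
have nm'd : adj m' d = false by rewrite adjC (no_triangle (y := m)) // adjC.
have dm' : deg F m' <= 1.
  have [||//|[d2 m'a]] := @rooted c a bc cd cFn mc aF ma.
  - by rewrite !in_setU !in_set1 !negb_or neq_adj // ac eq_sym neq_adj.
  - by move=> x xF dx xm; have [] := leaves x xF dx xm.
  have [||//|[_ m'c]] := @rooted a c (etrans (adjC b a) ab) (etrans (adjC a d) da) aF ma cFn mc.
  - by rewrite !in_setU !in_set1 !negb_or eq_sym neq_adj // eq_sym ac neq_adj.
  - by move=> x xF dx xm; have [] := leaves x xF dx xm.
  have := m'F; rewrite in_off_cycle => /and5P[_ _ _ _ /big_deg].
  by rewrite deg_off_cycle d2 nm'b nm'd (negbTE m'a) (negbTE m'c).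
have [m'a m'c] := leaves m' m'F dm' m'm.
have uniq_m' w : w \in F -> adj m' w -> w = m.
  by move=> wF mw; apply: (deg_le1_uniq dm') => //; rewrite adjC.
(* The rest of the forest would have two leaves, both adjacent to [a]; together with [a] it would be
   a core disjoint from the four-cycle on [m], [b], [c], [d]. *)
have FE : F = [set m; m'].
  apply/eqP; rewrite eq_sym eqEsubset; apply/andP; split.
    by apply/subsetP => w; rewrite in_set2 => /orP[]/eqP->.
  rewrite -setD_eq0 -[_ == _]negbK; apply/negP => F20.
  have cF2 : core_free (F :\: [set m; m']) by apply: core_freeS cF; apply: subsetDl.
  set F2 := F :\: _ in F20 cF2.
  have inF2 w : w \in F2 -> [/\ w != m, w != m' & w \in F].
    by rewrite in_setD in_set2 negb_or => /andP[/andP[]].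
  have dF2 w : w \in F2 -> deg F2 w = deg F w.
    move=> /inF2[wm wm' wF].
    have nwm : adj w m = false.
      by apply: contraNF wm' => h; apply/eqP/uniq_m; rewrite // adjC.
    have nwm' : adj w m' = false.
      by apply: contraNF wm => h; apply/eqP/uniq_m'; rewrite // adjC.
    have m'F' : m' \in F :\ m by rewrite in_setD1 m'm.
    by rewrite (degD1 w mF) nwm (degD1 w m'F') nwm' setDDl.
  have [y1 y1F2 dy1] := core_free_leaf cF2 F20.
  have [y1m y1m' y1F] := inF2 y1 y1F2.
  have F2y1 : F2 != [set y1].
    apply: contraTneq (off_cycle_deg_gt0 y1F) => F2E.
    by rewrite -dF2 // F2E deg1 adjI.
  have [y2 [y2F2 y21 dy2]] := core_free_leaf_neq cF2 y1F2 F2y1.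
  have [y2m y2m' y2F] := inF2 y2 y2F2.
  have aF2 : a \notin F2 by apply: contra aF => /inF2[].
  have lf w : w \in F2 -> deg F w <= 1 -> adj w a.
    by move=> /inF2[wm _ wF] dw; have [] := leaves w wF dw wm.
  have cA : core (a |: F2).
    split; first by apply/set0Pn; exists a; apply: setU11.
    move=> w; rewrite in_setU1 => /orP[/eqP->|wF2].
      apply/deg_gt1P; exists y1, y2; rewrite !in_setU1 y1F2 y2F2 !orbT eq_sym y21.
      by rewrite ![adj a _]adjC !lf // -dF2.
    have [wm _ wF] := inF2 w wF2.
    rewrite degU1 // dF2 //; have [d1|d2] := leqP (deg F w) 1.
      by rewrite lf // (off_cycle_leaf wF d1).1.
    by apply: leq_trans d2 (leq_addl _ _).
  have [x xA] := no_disjoint_cores cA (cyc c bc cd cFn mc).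
  move: xA; rewrite in_setU1 => /orP[/eqP->|/inF2[xm _ xF]].
    rewrite !in_setU !in_set1 [a == m]eq_sym (negbTE ma) (negbTE ac).
    by rewrite (negbTE (neq_adj ab)) eq_sym (negbTE (neq_adj da)).
  move: xF; rewrite in_off_cycle => /and5P[_ xb xc xd _].
  by rewrite !in_setU !in_set1 (negbTE xm) (negbTE xb) (negbTE xc) (negbTE xd).
have m'C : [/\ m' != a, m' != b, m' != c & m' != d].
  by have := m'F; rewrite in_off_cycle => /and5P[].
have nma : adj m a = false by rewrite (no_triangle (y := b)) // adjC.
have nmc : adj m c = false by rewrite (no_triangle (y := b)).
have nac : adj a c = false by rewrite (no_triangle (y := b)).
have nbd : adj b d = false by rewrite (no_triangle (y := c)).
have inR x : x \in W :\: [set a; c; m] -> [\/ x = b, x = d | x = m'].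
  rewrite in_setD !in_setU !in_set1 !negb_or -!andbA => /and4P[xa xc xm xW].
  have [->|xb] := eqVneq x b; first by constructor 1.
  have [->|xd] := eqVneq x d; first by constructor 2.
  have : x \in F by rewrite in_off_cycle xa xb xc xd.
  by rewrite FE in_set2 (negbTE xm) => /eqP->; constructor 3.
exists a, c, m; split; first by split; rewrite // eq_sym.
split.
- move=> u v; rewrite !in_setU !in_set1 -!orbA => /or3P[]/eqP-> /or3P[]/eqP->;
  by rewrite ?adjI // adjC.
- by move=> u v /inR[]-> /inR[]->; rewrite ?adjI // adjC.
- move=> u v /inR[]->; rewrite !in_setU !in_set1 -!orbA => /or3P[]/eqP->;
  by rewrite // adjC.
Qed.

(* The case of K_{3,n}: {a, c, z} against b, d and the leaves. *)
Lemma all_leaves_K3n :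
  (forall x, x \in F -> deg F x <= 1 -> adj x a /\ adj x c) -> is_K3n.
Proof.
move=> leaves; have cF := core_free_off_cycle.
have ba := etrans (adjC b a) ab; have cb := etrans (adjC c b) bc.
have dc := etrans (adjC d c) cd; have ad := etrans (adjC a d) da.
have inFn x : x \in F -> [/\ x != a, x != b, x != c & x != d].
  by rewrite in_off_cycle => /and5P[].
have [L inL] : exists L : {set V}, forall x, (x \in L) = (x \in F) && (deg F x <= 1).
  by exists [set x in F | deg F x <= 1] => x; rewrite inE.
have [F1 inF1] : exists F1 : {set V}, forall x, (x \in F1) = (x \in F) && (1 < deg F x).
  by exists [set x in F | 1 < deg F x] => x; rewrite inE.
have leafL x : x \in L -> [/\ x \in F, deg F x = 1, adj x a & adj x c].
  rewrite inL => /andP[xF dx]; have [xa xc] := leaves x xF dx.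
  by split=> //; have [] := off_cycle_leaf xF dx.
have F1F x : x \in F1 -> x \in F by rewrite inF1 => /andP[].
have F1L x : x \in F1 -> x \notin L.
  by rewrite inF1 inL negb_and -ltnNge orbC => /andP[_ ->].
have FL1 x : x \in F -> x \notin L -> x \in F1.
  by move=> xF; rewrite inL inF1 xF /= -ltnNge.
have degF x : deg F x = deg L x + deg F1 x.
  rewrite -degD; last by apply: disjoint_off_cycle => y yL; apply: contraTN yL; apply: F1L.
  congr (deg _ x); apply/setP => y; rewrite in_setU inL inF1 ltnNge.
  by case: (y \in F) => //=; rewrite orbN.
have LL x y : x \in L -> y \in L -> adj x y = false.
  move=> /leafL[_ _ xa _] /leafL[_ _ ya _]; rewrite (no_triangle (y := a)) //.
  by rewrite adjC.
have L_uniq x z z' : x \in L -> z \in F -> z' \in F -> adj x z -> adj x z' -> z = z'.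
  by move=> /leafL[xF dx _ _]; apply: deg_le1_uniq; rewrite dx.
have L_nbr x : x \in L -> exists2 z, z \in F1 & adj x z.
  move=> xL; have [_ dx _ _] := leafL x xL.
  have /deg_gt0P[z zF xz] : 0 < deg F x by rewrite dx.
  by exists z => //; apply: FL1 => //; apply: contraTN xz => zL; rewrite LL.
have Lbd x : x \in L -> adj x b = false /\ adj x d = false.
  by move=> /leafL[_ _ xa _]; split; apply: no_triangle xa _.
have [aW bW cW dW] := cycle_big.
have nac : adj a c = false by apply: no_triangle ab bc.
have nbd : adj b d = false by apply: no_triangle bc cd.
have side e : e = b \/ e = d -> [/\ adj e a, adj e c & exists2 y, y \in F1 & adj e y].
  move=> eE; have [ea ec eW] : [/\ adj e a, adj e c & e \in W] by case: eE => ->.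
  split=> //; have ebd : adj e b = false /\ adj e d = false.
    by case: eE => ->; rewrite adjI ?nbd // adjC nbd.
  have : 0 < deg F e.
    by have := big_deg eW; rewrite deg_off_cycle ea ec ebd.1 ebd.2; clear; lia.
  case/deg_gt0P => y yF ey; exists y => //; apply: FL1 => //; apply/negP => yL.
  by have [] := Lbd y yL; case: eE ey => ->; rewrite adjC => ->.
have nza z : 0 < deg L z -> adj z a = false /\ adj z c = false.
  case/deg_gt0P => l /leafL[_ _ la lc] zl.
  by split; apply: no_triangle zl _.
(* Here [l] is the only leaf at [z]. The cycle [z l y e] leaves a forest containing [y'] and [e'].
   Its low-degree vertex other than [y'] is neither [e'] nor a leaf of [F], since these keep two
   neighbours; so it has lost [z], and is the only neighbour [x] of [z] in [F1]. *)
have main z y y' e e' l x : z \in F1 -> deg F1 z <= 1 -> deg L z = 1 ->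
    adj z e -> adj z e' = false -> l \in L -> adj z l -> x \in F1 -> adj z x ->
    e = b /\ e' = d \/ e = d /\ e' = b -> y = a /\ y' = c \/ y = c /\ y' = a ->
    [/\ deg F x = 2, adj x y' = false & adj x e' = false].
  move=> zF1 dz1 dzL ze ze' lL zl xF1 zx eE yE.
  have [lF dl la lc] := leafL l lL; have zF := F1F z zF1.
  have [zna znb znc znd] := inFn z zF; have [lna lnb lnc lnd] := inFn l lF.
  have [e'a e'c [v vF1 e'v]] : [/\ adj e' a, adj e' c & exists2 y, y \in F1 & adj e' y].
    by apply: side; case: eE => -[_ ->]; [right|left].
  have vF := F1F v vF1; have [vna vnb vnc vnd] := inFn v vF.
  have [ly ye zy le] : [/\ adj l y, adj y e, z != y & l != e].
    by case: yE eE => -[-> _] [] [-> _].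
  have y'F : y' \notin F.
    by apply/negP => /inFn[]; case: yE => -[_ ->]; rewrite eqxx.
  have e'F : e' \notin F.
    by apply/negP => /inFn[]; case: eE => -[_ ->]; rewrite eqxx.
  have y'e' : y' != e'.
    by apply: neq_adj; rewrite adjC; case: yE => -[_ ->].
  have e'y' : adj e' y' by case: yE => -[_ ->].
  have lz : l != z by apply: contraTneq zF1 => <-; apply: contraTN lL; apply: F1L.
  pose Y := F :\ z :\ l; pose X := y' |: (e' |: Y).
  have inY w : (w \in Y) = [&& w != l, w != z & w \in F] by rewrite !in_setD1.
  have e'Y : e' \notin Y by rewrite inY (negbTE e'F) !andbF.
  have y'Y : y' \notin e' |: Y by rewrite in_setU1 inY (negbTE y'F) !andbF orbF.
  have cX : core_free X.
    have cS : core [set z; l; y; e] by apply: core4; rewrite // adjC.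
    apply: core_free_compl cS _; apply: disjoint_off_cycle => w.
    rewrite !in_setU !in_set1 inY -!orbA => /or4P[]/eqP->; rewrite ?eqxx ?andbF ?orbF.
    - by rewrite negb_or; case: eE yE => -[_ ->] [] [_ ->]; rewrite ?zna ?znb ?znc ?znd.
    - by rewrite negb_or; case: eE yE => -[_ ->] [] [_ ->]; rewrite ?lna ?lnb ?lnc ?lnd.
    - rewrite !negb_or; apply/and3P; split.
      + by case: yE => -[-> ->]; rewrite // eq_sym.
      + by case: yE => -[-> _]; rewrite eq_sym neq_adj.
      + rewrite !negb_and !negbK; apply/orP; right; apply/orP; right.
        by apply/negP => /inFn[]; case: yE => -[-> _]; rewrite eqxx.
    - rewrite !negb_or; apply/and3P; split.
      + by apply: neq_adj; case: yE => -[_ ->]; case: eE => -[-> _].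
      + by case: eE => -[-> ->]; rewrite // eq_sym.
      + rewrite !negb_and !negbK; apply/orP; right; apply/orP; right.
        by apply/negP => /inFn[]; case: eE => -[-> _]; rewrite eqxx.
  have Xy' : X != [set y'].
    apply: contraNneq y'e' => /setP/(_ e'); rewrite in_setU1 setU11 orbT in_set1.
    by rewrite eq_sym => /esym.
  have [w [wX wy' dw]] := core_free_leaf_neq cX (setU11 _ _) Xy'.
  have two p q : p \in X -> q \in X -> p != q -> adj w p -> adj w q -> False.
    move=> pX qX pq wp wq; suff : 1 < deg X w by rewrite ltnNge dw.
    by apply/deg_gt1P; exists p, q.
  have y'X : y' \in X by apply: setU11.
  have FX u : u \in F -> u != z -> u != l -> u \in X.
    by move=> uF uz ul; rewrite !in_setU1 inY uF uz ul !orbT.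
  move: wX; rewrite !in_setU1 (negbTE wy') /= => /orP[/eqP we'|].
    have vz : v != z by apply: contraFneq ze' => <-; rewrite adjC.
    have vl : v != l by apply: contraTneq lL => <-; apply: F1L.
    case: (@two y' v y'X (FX v vF vz vl)); rewrite ?we' //.
    by apply: contraNneq y'F => ->.
  rewrite inY => /and3P[wl wz wF].
  have [wL|wNL] := boolP (w \in L).
    have [w' w'F1 ww'] := L_nbr w wL; have w'F := F1F w' w'F1.
    have [_ _ wa wc] := leafL w wL.
    have w'z : w' != z.
      apply: contraNneq wl => w'z; apply/eqP.
      by apply: (@deg_le1_uniq L z); rewrite ?dzL // -w'z adjC.
    have w'l : w' != l by apply: contraTneq w'F1 => ->; apply: contraTN lL; apply: F1L.
    case: (@two y' w' y'X (FX w' w'F w'z w'l)) => //.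
    - by apply: contraNneq y'F => ->.
    - by case: yE => -[_ ->].
  have wF1 := FL1 w wF wNL.
  have wl' : adj w l = false.
    apply: contraNF wz => wl'; apply/eqP/(L_uniq l) => //; first by rewrite adjC.
    by rewrite adjC.
  have lFz : l \in F :\ z by rewrite in_setD1 lz.
  have dwF : deg F w = adj w z + deg Y w.
    by rewrite (degD1 w zF) (degD1 w lFz) wl'.
  have dwX : deg X w = adj w y' + (adj w e' + deg Y w) by rewrite !degU1.
  have dw2 : 1 < deg F w by move: wF1; rewrite inF1 => /andP[].
  have wz' : adj w z by move: dw dwX dwF dw2; clear; case: (adj w z) => //=; lia.
  have <- : w = x by apply: (deg_le1_uniq dz1); rewrite // adjC.
  rewrite wz' in dwF; move: dw dwX dwF dw2; clear.
  by case: (adj w y'); case: (adj w e') => /=; [lia..|split=> //; lia].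
(* Applying [main] with [a] and [c] exchanged strips [x] of both, and the edge [z x] excludes [e]
   for lack of triangles: [x] would have degree 2. *)
have final z e e' : z \in F1 -> deg F1 z <= 1 -> deg L z = 1 ->
    e = b /\ e' = d \/ e = d /\ e' = b -> adj z e -> adj z e' = false -> False.
  move=> zF1 dz1 dzL eE ze ze'.
  have /deg_gt0P[l lL zl] : 0 < deg L z by rewrite dzL.
  have /deg_gt0P[x xF1 zx] : 0 < deg F1 z.
    by have := zF1; rewrite inF1 degF dzL => /andP[_]; clear; lia.
  have [d2 xc xe'] := main z a c e e' l x zF1 dz1 dzL ze ze' lL zl xF1 zx eE
    (or_introl (conj erefl erefl)).
  have [_ xa _] := main z c a e e' l x zF1 dz1 dzL ze ze' lL zl xF1 zx eE
    (or_intror (conj erefl erefl)).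
  have xe : adj x e = false by rewrite (@no_triangle x z) // adjC.
  have := F1F x xF1; rewrite in_off_cycle => /and5P[_ _ _ _ /big_deg].
  rewrite deg_off_cycle d2 xa xc.
  by case: eE xe xe' => -[-> ->] -> ->.
(* Two leaves at [z] close a four-cycle through [y]. A single one closes a four-cycle with [e],
   since by [final] the vertex [z] then sees both [b] and [d]. At two different leaves of [F1], the
   choices [a], [b] for one and [c], [d] for the other give disjoint cycles. *)
have zcore z y e : z \in F1 -> deg F1 z <= 1 -> y = a \/ y = c -> e = b \/ e = d ->
    exists S, core S /\ forall x, x \in S -> [|| x == z, x == y, x == e | (x \in L) && adj z x].
  move=> zF1 dz1 yE eE.
  have Ly l : l \in L -> adj l y by move=> /leafL[_ _ la lc]; case: yE => ->.
  have zF := F1F z zF1; have [zna znb znc znd] := inFn z zF.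
  have zy : z != y by case: yE => ->.
  have dz : 0 < deg L z.
    by have := zF1; rewrite inF1 degF => /andP[_]; move: dz1; clear; lia.
  have [d2|d1] := ltnP 1 (deg L z).
    have /deg_gt1P[l [l' [lL l'L ll' zl zl']]] := d2.
    exists [set z; l; y; l']; split.
      by apply: core4; rewrite ?Ly // adjC // Ly.
    move=> x; rewrite !in_setU !in_set1 -!orbA => /or4P[]/eqP->;
    by rewrite ?eqxx ?orbT // ?lL ?l'L ?zl ?zl' ?orbT.
  have dL : deg L z = 1 by move: dz d1; clear; lia.
  have ze : adj z e.
    have [za zc] := nza z dz.
    have : adj z b || adj z d.
      have := F1F z zF1; rewrite in_off_cycle => /and5P[_ _ _ _ /big_deg].
      rewrite deg_off_cycle degF dL za zc; move: dz1; clear.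
      by case: (adj z b); case: (adj z d) => //=; lia.
    case: eE => ->; case zb: (adj z b); case zd: (adj z d) => //= _.
      by case: (@final z d b); rewrite // ?zb ?zd //; right.
    by case: (@final z b d); rewrite // ?zb ?zd //; left.
  have [l lL zl] := deg_gt0P _ _ dz.
  exists [set z; l; y; e]; split.
    apply: core4 => //; [exact: Ly| |by rewrite adjC|].
      by case: yE eE => -> [] ->.
    have [lF _ _ _] := leafL l lL; have [_ lb _ ld] := inFn l lF.
    by case: eE => ->.
  move=> x; rewrite !in_setU !in_set1 -!orbA => /or4P[]/eqP->;
  by rewrite ?eqxx ?orbT // lL zl !orbT.
have [_ _ [y0 y0F1 by0]] := side b (or_introl erefl).
have cF1 : core_free F1 by apply: core_freeS cF; apply/subsetP => x; apply: F1F.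
have F10 : F1 != set0 by apply/set0Pn; exists y0.
have [z zF1 dz] := core_free_leaf cF1 F10.
have [F1E|F1z] := eqVneq F1 [set z]; last first.
  have [z' [z'F1 z'z dz']] := core_free_leaf_neq cF1 zF1 F1z.
  have [S [cS SE]] := zcore z a b zF1 dz (or_introl erefl) (or_introl erefl).
  have [S' [cS' SE']] := zcore z' c d z'F1 dz' (or_intror erefl) (or_intror erefl).
  have [x /SE xS /SE' xS'] := no_disjoint_cores cS cS'; exfalso.
  have [zna znb znc znd] := inFn z (F1F z zF1).
  have [z'na z'nb z'nc z'nd] := inFn z' (F1F z' z'F1).
  have LN y : y \in L -> [/\ y != a, y != b, y != c & y != d] by move=> /leafL[/inFn].
  case/or4P: xS xS' => [/eqP->|/eqP->|/eqP->|/andP[xL zx]].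
  - rewrite eq_sym (negbTE z'z) (negbTE znc) (negbTE znd) (negbTE (F1L z zF1)).
    by [].
  - rewrite eq_sym (negbTE z'na) (negbTE ac) (negbTE (neq_adj ad)) /=.
    by case/andP=> /LN[]; rewrite eqxx.
  - rewrite eq_sym (negbTE z'nb) (negbTE (neq_adj bc)) (negbTE bd) /=.
    by case/andP=> /LN[_]; rewrite eqxx.
  - have [_ _ xc xd] := LN x xL; rewrite (negbTE xc) (negbTE xd) /=.
    have xz' : x != z' by apply: contraTneq xL => ->; apply: F1L.
    rewrite (negbTE xz') xL /= => z'x.
    have := L_uniq x z z' xL (F1F z zF1) (F1F z' z'F1); rewrite ![adj x _]adjC => /(_ zx z'x) zz'.
    by rewrite zz' eqxx in z'z.
have F1_eq x : x \in F1 -> x = z by rewrite F1E in_set1 => /eqP.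
have zside e : e = b \/ e = d -> adj e z.
  by move=> /side[_ _ [y /F1_eq-> ]].
have Lz x : x \in L -> adj x z by move=> /L_nbr[y /F1_eq->].
have [za zc] : adj z a = false /\ adj z c = false.
  apply: nza; have := zF1; rewrite inF1 degF F1E deg1 adjI => /andP[_].
  by clear; lia.
have inR x : x \in W :\: [set a; c; z] -> x = b \/ x = d \/ x \in L.
  rewrite in_setD !in_setU !in_set1 !negb_or -!andbA => /and4P[xa xc xz xW].
  have [->|xb] := eqVneq x b; first by left.
  have [->|xd] := eqVneq x d; first by right; left.
  have xF : x \in F by rewrite in_off_cycle xa xb xc xd.
  right; right; apply/negPn/negP => /(FL1 x xF)/F1_eq xzE.
  by rewrite xzE eqxx in xz.
have [zna znb znc znd] := inFn z (F1F z zF1).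
exists a, c, z; split; first by split; rewrite // eq_sym.
split.
- move=> u v; rewrite !in_setU !in_set1 -!orbA => /or3P[]/eqP-> /or3P[]/eqP->;
  by rewrite ?adjI // adjC.
- have Lb x : x \in L -> adj x b = false by case/Lbd.
  have Ld x : x \in L -> adj x d = false by case/Lbd.
  move=> u v /inR[->|[->|uL]] /inR[->|[->|vL]];
  first [exact: adjI|exact: nbd|exact: LL|exact: Lb|exact: Ld
        |by rewrite adjC; first [exact: nbd|exact: Lb|exact: Ld]].
- move=> u v /inR uE; rewrite !in_setU !in_set1 -!orbA => /or3P[]/eqP->.
  + by case: uE => [->|[->|/leafL[]]].
  + by case: uE => [->|[->|/leafL[]]].
  + by case: uE => [->|[->|/Lz]] //; apply: zside; [left|right].
Qed.

End FourCycle.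

(** A leaf outside the four-cycle sees either [a], [c] or [b], [d]. Two leaves of each kind would
    close two disjoint four-cycles, so one kind occurs at most once; up to rotating the cycle these
    are the two cases treated above. *)
Lemma order5_or_K3n : W != set0 -> #|W| = 5 \/ is_K3n.
Proof.
move=> W0; have [[x [y [z [xy yz xz]]]]|notri'] :=
    pselect (exists x y z, [/\ adj x y, adj y z & adj x z]).
  by left; apply: triangle_order5 xy yz xz.
have notri : triangle_free.
  by move=> x y z xy yz xz; apply: notri'; exists x, y, z.
have [a [b [c [d [[ab bc cd da] [ac bd]]]]]] := four_cycle notri W0; right.
have FE : off_cycle b c d a = off_cycle a b c d.
  apply/setP => x; rewrite !in_off_cycle.
  by case: (x == a); case: (x == b); case: (x == c); case: (x == d).
have leafP := off_cycle_leaf notri ab bc cd da ac bd.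
set F := off_cycle a b c d in FE leafP.
have [[m [mF dm mb md]]|no2] := pselect (exists m, [/\ m \in F, deg F m <= 1, adj m b & adj m d]);
  last first.
  apply: (all_leaves_K3n notri ab bc cd da ac bd) => x xF dx.
  have [_ /orP[/andP[]//|/andP[xb xd]]] := leafP x xF dx.
  by case: no2; exists x.
have [[l [lF dl la lc]]|no1] := pselect (exists l, [/\ l \in F, deg F l <= 1, adj l a & adj l c]);
  last first.
  apply: (all_leaves_K3n notri bc cd da ab bd); rewrite 1?eq_sym // FE => x xF dx.
  have [_ /orP[/andP[xb xd]|/andP[]//]] := leafP x xF dx.
  by case: no1; exists x.
have [[m2 [m2F dm2 m2b m2d m2m]]|one2] := pselect (exists m2,
    [/\ m2 \in F, deg F m2 <= 1, adj m2 b, adj m2 d & m2 != m]); last first.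
  apply: (one_leaf_K3n notri ab bc cd da ac bd mF mb md dm) => x xF dx xm.
  have [_ /orP[/andP[]//|/andP[xb xd]]] := leafP x xF dx.
  by case: one2; exists x.
have [[l2 [l2F dl2 l2a l2c l2l]]|one1] := pselect (exists l2,
    [/\ l2 \in F, deg F l2 <= 1, adj l2 a, adj l2 c & l2 != l]); last first.
  apply: (@one_leaf_K3n notri b c d a bc cd da ab bd _ l); rewrite 1?eq_sym ?FE //.
  move=> x xF dx xm; have [_ /orP[/andP[xb xd]|/andP[]//]] := leafP x xF dx.
  by case: one1; exists x.
exfalso.
have inFn x : x \in F -> [/\ x != a, x != b, x != c & x != d].
  by rewrite in_off_cycle => /and5P[].
have ltype x : adj x a -> adj x b -> False by move=> xa xb; exact: (notri x a b).
have cl : core [set l; a; l2; c] by apply: core4 => //; rewrite 1?adjC // eq_sym.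
have cm : core [set m; b; m2; d] by apply: core4 => //; rewrite 1?adjC // eq_sym.
have [x] := no_disjoint_cores cl cm.
have [la' lb' lc' ld'] := inFn l lF; have [l2a' l2b' l2c' l2d'] := inFn l2 l2F.
have [ma' mb' mc' md'] := inFn m mF; have [m2a' m2b' m2c' m2d'] := inFn m2 m2F.
have lm u v : adj u a -> adj v b -> (u == v) = false.
  by move=> ua vb; apply/eqP => uv; apply: (ltype u); rewrite // uv.
rewrite !in_setU !in_set1 -!orbA => /or4P[]/eqP->.
- by rewrite (lm l m) // (lm l m2) // (negbTE lb') (negbTE ld').
- rewrite [a == m]eq_sym [a == m2]eq_sym [a == d]eq_sym (negbTE ma') (negbTE m2a').
  by rewrite (negbTE (neq_adj ab)) (negbTE (neq_adj da)).
- by rewrite (lm l2 m) // (lm l2 m2) // (negbTE l2b') (negbTE l2d').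
- rewrite [c == m]eq_sym [c == m2]eq_sym [c == b]eq_sym (negbTE mc') (negbTE m2c').
  by rewrite (negbTE (neq_adj bc)) (negbTE (neq_adj cd)).
Qed.

End SimpleGraph.

Local Open Scope group_scope.

(** * Finitely generated families and solutions *)

(** For involutions such a list contains the subgroup they generate. Asking only for stability
    spares the construction of that subgroup and allows lists that are larger than needed. *)
Definition fin_gen (I : Type) (H : groupType) (x : I -> H) : Prop :=
  exists s : seq H, 1 \in s /\ forall h i, h \in s -> h * x i \in s.

Lemma prodg_perm (I : eqType) (H : groupType) (x : I -> H) (s t : seq I) :
  {in s &, forall i j, commute (x i) (x j)} -> perm_eq s t ->
  \prod_(i <- s) x i = \prod_(i <- t) x i.
Proof.
elim: s t => [|i s IHs] t cs; first by rewrite perm_sym => /perm_nilP ->.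
move=> est; have it : i \in t by rewrite -(perm_mem est) mem_head.
case/splitPr: it est => t1 t2 est.
have est' : perm_eq s (t1 ++ t2).
  by rewrite -(perm_cons i) (permPl est) -cat_cons perm_catC /= perm_cons perm_catC.
have sub j : j \in s -> j \in i :: s by rewrite inE orbC => ->.
rewrite big_cons big_cat big_cons /= (IHs (t1 ++ t2)) //; last first.
  by move=> j k /sub js /sub ks; apply: cs.
rewrite big_cat /= !mulgA; congr (_ * _).
rewrite big_seq; apply: commute_prod => j jt1.
by apply: cs; rewrite ?mem_head ?(perm_mem est) // mem_cat jt1.
Qed.

Record solution (G : mgraph) (H : groupType) (x : edge G -> H) : Prop := Solution {
  solution_sq : forall e, x e * x e = 1;
  solution_comm : forall v e e', e \in incident v -> e' \in incident v ->
    commute (x e) (x e');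
  solution_vertex : forall v, \prod_(e <- enum (incident v)) x e = 1
}.

(** By the universal property this is finiteness of the quotient of the incidence group by [J].
    Quantifying over every group lets a solution on a minor be extended inside the same group. *)
Definition finite_type (G : mgraph) : Prop :=
  forall (H : groupType) (x : edge G -> H), solution x -> fin_gen x.

Lemma solution_prod (G : mgraph) (H : groupType) (x : edge G -> H) v s :
  solution x -> uniq s -> s =i incident v -> \prod_(e <- s) x e = 1.
Proof.
move=> solx us es; rewrite -[RHS](solution_vertex solx v); apply: prodg_perm.
  by move=> e e'; rewrite !es; apply: solution_comm.
by apply: uniq_perm (enum_uniq _) _ => // e; rewrite mem_enum es.
Qed.

Lemma involution_inv (H : groupType) (h : H) : h * h = 1 -> h^-1 = h.
Proof. exact: mulg1_eq. Qed.

Lemma involution_prod (I : eqType) (H : groupType) (x : I -> H) (s : seq I) :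
  {in s &, forall i j, commute (x i) (x j)} -> {in s, forall i, x i * x i = 1} ->
  (\prod_(i <- s) x i) * (\prod_(i <- s) x i) = 1.
Proof.
elim: s => [|i s IHs] cs xs; first by rewrite big_nil mulg1.
have sub j : j \in s -> j \in i :: s by rewrite inE orbC => ->.
rewrite big_cons {2}big_seq.
have /commute_sym cP : commute (x i) (\prod_(j <- s | j \in s) x j).
  by apply: commute_prod => j js; apply: cs; rewrite ?mem_head ?sub.
rewrite -big_seq in cP *.
rewrite -mulgA [X in _ * X]mulgA cP -mulgA mulgA xs ?mem_head // mul1g.
by apply: IHs => [j k /sub js /sub ks|j /sub]; [apply: cs|apply: xs].
Qed.

(** * Relations modulo a central involution *)

Definition eqmod (H : groupType) (z g h : H) : Prop := g = h \/ g = z * h.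

(** Since [z] is an involution commuting with all values of [f], a relation valid up to [z] may be
    applied inside a word. This takes the place of a quotient by [z]. *)
Lemma word_eval_eqmod (X : choiceType) (rel : word X -> word X -> Prop)
    (H : groupType) (f : X -> H) (z : H) :
  z * z = 1 -> (forall i, commute z (f i)) ->
  (forall u v, rel u v -> eqmod z (word_eval f u) (word_eval f v)) ->
  forall u v, word_eq rel u v -> eqmod z (word_eval f u) (word_eval f v).
Proof.
move=> zz zf fR.
have zE u : commute z (word_eval f u).
  by apply: commute_prod => -[i []] _ //=; apply: commuteV.
move=> u v; elim=> {u v} [//|[i b]|u|u v _ [->|->]|u v w _ uv _ vw|].
- left; rewrite /word_eval !big_cons !big_nil /= mulg1.
  by case: b; rewrite /= ?mulVg ?mulgV.
- by left.
- by left.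
- by right; rewrite mulgA zz mul1g.
- case: uv vw => -> [->|->]; rewrite ?mulgA ?zz ?mul1g; by [left|right].
- move=> u u' v v' _ eu _ ev; rewrite !word_eval_cat.
  case: eu ev => -> [->|->]; first by left.
  + by right; rewrite mulgA -(zE u') mulgA.
  + by right; rewrite mulgA.
  + by left; rewrite mulgA -[z * _ * z]mulgA -(zE u') mulgA zz mul1g.
Qed.

Section UncolouredGroup.
Variable G : mgraph.

Inductive uncoloured_rel : word (edge G) -> word (edge G) -> Prop :=
| uncoloured_sq e : uncoloured_rel (word_gen e ++ word_gen e) [::]
| uncoloured_comm v e e' : e \in incident v -> e' \in incident v ->
    uncoloured_rel (word_gen e ++ word_gen e') (word_gen e' ++ word_gen e)
| uncoloured_vertex v :
    uncoloured_rel [seq (e, false) | e <- enum (incident v)] [::].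

Lemma word_eval_gens (H : groupType) (X : choiceType) (f : X -> H) (s : seq X) :
  word_eval f [seq (i, false) | i <- s] = \prod_(i <- s) f i.
Proof. by rewrite /word_eval big_map. Qed.

Lemma word_eval_gen (H : groupType) (X : choiceType) (f : X -> H) i :
  word_eval f (word_gen i) = f i.
Proof. by rewrite /word_eval big_seq1. Qed.

Lemma uncoloured_solution : solution (@pgen _ uncoloured_rel).
Proof.
split=> [e|v e e' ev e'v|v].
- have /presented_relP := uncoloured_sq e.
  by rewrite word_eval_cat !word_eval_gen /word_eval big_nil.
- have /presented_relP := uncoloured_comm ev e'v.
  by rewrite !word_eval_cat !word_eval_gen.
- have /presented_relP := uncoloured_vertex v.
  by rewrite word_eval_gens /word_eval big_nil.
Qed.

(* The congruence of words survives modulo z, so that the finitely many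
   elements of the uncoloured group, doubled by z, cover the subgroup. *)
Lemma fin_gen_central (H : groupType) (x : edge G -> H) (z : H) :
  finite_type G -> z * z = 1 -> (forall e, commute z (x e)) ->
  (forall e, eqmod z (x e * x e) 1) ->
  (forall v e e', e \in incident v -> e' \in incident v ->
     eqmod z (x e * x e') (x e' * x e)) ->
  (forall v, eqmod z (\prod_(e <- enum (incident v)) x e) 1) ->
  exists s : seq H, [/\ 1 \in s, forall h e, h \in s -> h * x e \in s
    & forall h, h \in s -> h * z \in s].
Proof.
move=> finG zz zx xx xC xv.
have relE u v : uncoloured_rel u v -> eqmod z (word_eval x u) (word_eval x v).
  case=> [e|w e e' ew e'w|w]; rewrite ?word_eval_cat ?word_eval_gen.
  - by rewrite /word_eval big_nil.
  - exact: xC ew e'w.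
  - by rewrite word_eval_gens /word_eval big_nil.
have wordE := word_eval_eqmod zz zx relE.
have [s [s1 sM]] := finG _ _ uncoloured_solution.
pose ev (q : presented uncoloured_rel) := word_eval x (repr q).
have evM q e : eqmod z (ev q * x e) (ev (q * pgen _ e)).
  rewrite /ev -[x e]word_eval_gen -word_eval_cat; apply: wordE.
  apply: word_eq_sym.
  have -> : q * pgen uncoloured_rel e =
      (\pi_(presented uncoloured_rel) (repr q ++ word_gen e))%qT.
    by rewrite -pmul_pi reprK.
  exact: repr_word_eq.
have ev1 : eqmod z 1 (ev 1).
  rewrite -[X in eqmod _ X](_ : word_eval x [::] = 1); last first.
    by rewrite /word_eval big_nil.
  by apply: wordE; apply: word_eq_sym; apply: repr_word_eq.
exists ([seq ev q | q <- s] ++ [seq z * ev q | q <- s]).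
have mem h q : q \in s -> eqmod z h (ev q) ->
    h \in [seq ev q | q <- s] ++ [seq z * ev q | q <- s].
  by move=> qs [->|->]; rewrite mem_cat; apply/orP; [left|right]; apply: map_f.
split; first exact: mem ev1.
  move=> h e; rewrite mem_cat => /orP[] /mapP[q qs ->].
    exact: mem (sM _ _ qs) (evM q e).
  apply: mem (sM q e qs) _; rewrite -mulgA.
  by case: (evM q e) => ->; [right|left; rewrite mulgA zz mul1g].
have zev q : commute z (ev q).
  by apply: commute_prod => -[e []] _ //=; apply: commuteV.
move=> h; rewrite mem_cat => /orP[] /mapP[q qs ->]; apply: (mem _ q qs).
  by right; rewrite zev.
by left; rewrite -mulgA -zev mulgA zz mul1g.
Qed.

End UncolouredGroup.

(** * The incidence group and its uncoloured quotient *)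

Section IncidenceGroupFinite.
Variables (G : mgraph) (b : vertex G -> 'Z_2).
Let gen : option (edge G) -> incidence_group b := @pgen _ (incidence_rel b).

Lemma incidence_seq_finite_type (s : seq (incidence_group b)) :
  (forall q, q \in s) -> finite_type G.
Proof.
(* [J] is sent to 1, so the colour disappears from the vertex relations. *)
move=> sT H x solx; pose f (i : option (edge G)) := oapp x 1 i.
have [u v|g [[gM ggen] _]] := @presented_lift _ (incidence_rel b) H f.
  case=> [|e|e|w e e' ew e'w|w];
    rewrite /word_comm /wx /wJ ?word_eval_cat /word_eval ?big_seq1 ?big_nil /=.
  - by rewrite mulg1.
  - exact: solution_sq.
  - by rewrite !gsimp.
  - by rewrite (solution_comm solx ew e'w) mulKg mulVg.
  - transitivity (1 : H).
      rewrite -[RHS](solution_vertex solx w).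
      elim: (enum _) => [|e l IH]; first by rewrite !big_nil.
      by rewrite !big_cons IH.
    by elim: (nat_of_ord (b w)) => [|k IH]; rewrite /= ?big_nil // big_cons -IH mulg1.
exists (map g s); split.
  have -> : 1 = g 1 by apply: (mulgI (g 1)); rewrite -gM !mulg1.
  exact: map_f.
by move=> h e /mapP[q _ ->]; rewrite -[x e](ggen (Some e)) -gM map_f.
Qed.

Lemma finite_type_incidence_seq :
  finite_type G -> exists s : seq (incidence_group b), forall q, q \in s.
Proof.
move=> finG; pose z := gen None; pose x e := gen (Some e).
have rel u v : incidence_rel b u v -> word_eval gen u = word_eval gen v.
  exact: presented_relP.
have zz : z * z = 1.
  have := rel _ _ (inc_J2 b); rewrite word_eval_cat !word_eval_gen => ->.
  by rewrite /word_eval big_nil.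
have xx e : x e * x e = 1.
  have := rel _ _ (inc_x2 b e); rewrite word_eval_cat !word_eval_gen => ->.
  by rewrite /word_eval big_nil.
have commE i j : word_eval gen (word_comm (word_gen i) (word_gen j)) = 1 ->
    commute (gen i) (gen j).
  rewrite /word_comm !word_eval_cat !word_eval_gen /word_eval !big_seq1 /= => cij.
  by apply/commgP; rewrite commgEl conjgE cij.
have zx e : commute z (x e).
  apply/commute_sym/commE; rewrite (rel _ _ (inc_xJ b e)).
  by rewrite /word_eval big_nil.
have xC v e e' : e \in incident v -> e' \in incident v -> commute (x e) (x e').
  move=> ev e'v; apply: commE; rewrite (rel _ _ (inc_xx b ev e'v)).
  by rewrite /word_eval big_nil.
have xv v : eqmod z (\prod_(e <- enum (incident v)) x e) 1.
  have -> : \prod_(e <- enum (incident v)) x e =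
      word_eval gen (flatten [seq wx e | e <- enum (incident v)]).
    elim: (enum _) => [|e l IH]; first by rewrite /word_eval !big_nil.
    by rewrite /= big_cons IH {2}/word_eval big_cons.
  rewrite (rel _ _ (inc_vertex b v)); case: (b v) => -[|[|//]] /= _.
    by left; rewrite /word_eval big_nil.
  by right; rewrite word_eval_gen mulg1.
have [s [s1 sx sz]] := fin_gen_central finG zz zx (fun e => or_introl (xx e))
  (fun v e e' ev e'v => or_introl (xC v e e' ev e'v)) xv.
exists s; elim/presentedW => u; rewrite -word_eval_pgen.
elim/last_ind: u => [|u [i c] IHu]; first by rewrite /word_eval big_nil.
have -> : word_eval gen (rcons u (i, c)) = word_eval gen u * gen i.
  rewrite -cats1 word_eval_cat; congr (_ * _).
  rewrite /word_eval big_seq1 /=; case: c => //=.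
  by apply: involution_inv; case: i => [e|]; [apply: xx|apply: zz].
by case: i => [e|]; [apply: sx|apply: sz].
Qed.

End IncidenceGroupFinite.

(** * Minors *)

Lemma prodg_pmap (I J : Type) (H : groupType) (p : I -> option J) (y : J -> H)
    (s : seq I) :
  \prod_(i <- s) oapp y 1 (p i) = \prod_(j <- pmap p s) y j.
Proof.
elim: s => [|i s IHs]; first by rewrite !big_nil.
by rewrite big_cons IHs /=; case: (p i) => [j|] /=; rewrite ?big_cons ?mul1g.
Qed.

Lemma ends_pair (G : mgraph) (e : edge G) : exists u v, u != v /\ ends e = [set u; v].
Proof.
have /eqP/cards2P[u [v [uv eE]]] := card_ends e.
by exists u, v.
Qed.

Lemma ends_mem2 (G : mgraph) (e : edge G) u v :
  u != v -> u \in ends e -> v \in ends e -> ends e = [set u; v].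
Proof.
move=> uv ue ve; apply/esym/eqP; rewrite eqEcard card_ends cards2 uv andbT.
by apply/subsetP => w; rewrite !inE => /orP[]/eqP->.
Qed.

Lemma finite_type_miso (H G : mgraph) : miso H G -> finite_type G -> finite_type H.
Proof.
move=> [f [g [[f' fK f'K] [g' gK g'K] gE]]] finG K y soly.
have incE v e : (g e \in incident (f v)) = (e \in incident v).
  by rewrite !inE gE mem_imset //; apply: can_inj fK.
have [|s [s1 sM]] := finG K (y \o g'); last first.
  by exists s; split=> // h e hs; have := sM h (g e) hs; rewrite /= gK.
split=> [e|v e e'|v] /=; first exact: solution_sq.
- rewrite -[v]f'K -[e]g'K -[e']g'K !incE !g'K.
  exact: solution_comm.
- rewrite -[RHS](@solution_prod _ _ y (f' v) (map g' (enum (incident v)))) //.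
  + by rewrite big_map.
  + by rewrite map_inj_uniq ?enum_uniq //; apply: can_inj g'K.
  + move=> e; rewrite -incE f'K -(mem_map (can_inj gK)) -map_comp.
    by rewrite (eq_map g'K) map_id mem_enum.
Qed.

Lemma finite_type_delete_edge (G : mgraph) (e : edge G) :
  finite_type G -> finite_type (delete_edge e).
Proof.
move=> finG K y soly; pose x (f : edge G) : K := oapp y 1 (insub f).
have xE (f : edge (delete_edge e)) : x (val f) = y f by rewrite /x valK.
have [|s [s1 sM]] := finG K x; last first.
  by exists s; split=> // h f hs; rewrite -xE; apply: sM.
split=> [f|v f f'|v]; rewrite /x.
- by case: insub => [f'|] /=; [exact: (solution_sq soly)|rewrite mulg1].
- rewrite !inE => vf vf'.
  case: insubP => [g _ gE|_] /=; last exact/commute_sym/commute1.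
  case: insubP => [g' _ g'E|_] /=; last exact/commute1.
  by apply: (solution_comm soly (v := v)); rewrite inE /= /del_edge_ends ?gE ?g'E.
- rewrite prodg_pmap; apply: (@solution_prod (delete_edge e) _ _ v _ soly).
    by rewrite pmap_sub_uniq ?enum_uniq.
  by move=> f; rewrite mem_pmap_sub mem_enum !inE.
Qed.

Lemma finite_type_delete_vertex (G : mgraph) (v : vertex G) :
  finite_type G -> finite_type (delete_vertex v).
Proof.
move=> finG K y soly; pose x (f : edge G) : K := oapp y 1 (insub f).
have xE (f : edge (delete_vertex v)) : x (val f) = y f by rewrite /x valK.
have [|s [s1 sM]] := finG K x; last first.
  by exists s; split=> // h f hs; rewrite -xE; apply: sM.
split=> [f|w f f'|w]; rewrite /x.
- by case: insub => [f'|] /=; [exact: (solution_sq soly)|rewrite mulg1].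
- rewrite !inE => wf wf'.
  case: insubP => [g vg gE|_] /=; last exact/commute_sym/commute1.
  case: insubP => [g' _ g'E|_] /=; last exact/commute1.
  have wv : w != v by apply: contraNneq vg => <-.
  apply: (solution_comm soly (v := exist _ w wv));
    by rewrite inE /= /del_vertex_ends inE /= ?gE ?g'E.
- have [->|wv] := eqVneq w v.
    apply: big1_seq => f; rewrite mem_enum inE /= => vf.
    by rewrite insubF //; apply/negbF.
  rewrite prodg_pmap; apply: (@solution_prod (delete_vertex v) _ _ (exist _ w wv) _ soly).
    by rewrite pmap_sub_uniq ?enum_uniq.
  by move=> f; rewrite mem_pmap_sub mem_enum !inE.
Qed.

(** The contracted edge receives the value forced at its end [u], the product [P u] of the surviving
    edges there; edges parallel to it receive 1. At the other end the relation becomes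
    [P u * P v = 1], which is the relation at the merged vertex. *)
Lemma finite_type_contract_edge (G : mgraph) (e : edge G) :
  finite_type G -> finite_type (contract_edge e).
Proof.
move=> finG K y soly.
pose cw (w : vertex G) : vertex (contract_edge e) := contract_vertex e w.
pose sub (f : edge G) : option (edge (contract_edge e)) := insub f.
have [u [v [uv eE]]] := ends_pair e.
pose E w := pmap sub (enum (incident w)).
pose P w := \prod_(f <- E w) y f.
pose x (f : edge G) : K := if f == e then P u else oapp y 1 (sub f).
have memE w f : (f \in E w) = (w \in ends (val f)).
  by rewrite mem_pmap_sub mem_enum inE.
have uE w : uniq (E w) by rewrite pmap_sub_uniq ?enum_uniq.
have subE w f : f \in E w -> f \in incident (cw w).
  by rewrite memE inE /= /contract_ends => wf; apply: imset_f.
have cv w : w \in ends e -> cw w = None.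
  by move=> we; rewrite /cw /contract_vertex insubF //; apply/negbF.
have ue : u \in ends e by rewrite eE set21.
have ve : v \in ends e by rewrite eE set22.
have yC w f g : f \in incident (cw w) ->
    g \in incident (cw w) -> commute (y f) (y g).
  exact: solution_comm.
have xy w f g : f \in incident w -> g \in incident (cw w) ->
    commute (x f) (y g).
  move=> fw gw; rewrite /x; case: eqP => [fe|_].
    apply/commute_sym; rewrite /P big_seq.
    apply: commute_prod => h hu; apply: (yC w) => //.
    by move: fw; rewrite fe inE => we; rewrite cv // -(cv u ue) subE.
  rewrite /sub; case: insubP => [h _ hE|_] /=; last exact/commute_sym/commute1.
  by apply: (yC w) => //; apply: subE; rewrite memE hE; move: fw; rewrite inE.
have xC w f g : f \in incident w -> g \in incident w -> commute (x f) (x g).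
  move=> fw gw; rewrite {2}/x; case: eqP => [ge|_].
    rewrite /P big_seq; apply: commute_prod => h hu; apply: (xy w) => //.
    by move: gw; rewrite ge inE => we; rewrite cv // -(cv u ue) subE.
  rewrite /sub; case: insubP => [h _ hE|_] /=; last exact/commute1.
  by apply: (xy w) => //; apply: subE; rewrite memE hE; move: gw; rewrite inE.
have PP : P u * P u = 1.
  apply: involution_prod => [f g fu gu|f _]; last exact: (solution_sq soly).
  by apply: (yC u); apply: subE.
have eNsub : sub e = None by rewrite /sub insubF //= eqxx.
have xe w : w \in ends e -> \prod_(f <- enum (incident w)) x f = P u * P w.
  move=> we; rewrite (@prodg_perm _ _ _ _ (e :: rem e (enum (incident w)))).
  - rewrite big_cons {1}/x eqxx /P -prodg_pmap -[in RHS]prodg_pmap; congr (_ * _).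
    have ew : e \in enum (incident w) by rewrite mem_enum inE.
    transitivity (\prod_(f <- rem e (enum (incident w))) oapp y 1 (sub f)).
      apply: eq_big_seq => f; rewrite mem_rem_uniq ?enum_uniq // => /andP[fe _].
      by rewrite /x (negbTE fe).
    have /perm_to_rem := ew; rewrite !prodg_pmap => /(perm_pmap sub) /= pE.
    rewrite eNsub /= perm_sym in pE.
    apply: (prodg_perm _ pE) => f g; rewrite (perm_mem pE) (perm_mem pE) => /subE fw /subE gw; exact: (yC w).
  - by move=> f g; rewrite !mem_enum; apply: xC.
  - by apply: perm_to_rem; rewrite mem_enum inE.
have [|s [s1 sM]] := finG K x; last first.
  exists s; split=> // h f hs; have <- : x (val f) = y f.
    have fe : val f != e by apply: contraNneq (valP f) => ->.
    by rewrite /x (negbTE fe) /sub valK.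
  exact: sM.
split=> [f|//|w].
- rewrite /x; case: eqP => // _.
  by case: (sub f) => [g|] /=; [exact: (solution_sq soly)|rewrite mulg1].
have [we|wNe] := boolP (w \in ends e); last first.
  rewrite (eq_big_seq (fun f => oapp y 1 (sub f))); last first.
    move=> f; rewrite mem_enum inE => wf; rewrite /x; case: eqP wf => // ->.
    by rewrite (negbTE wNe).
  rewrite prodg_pmap.
  apply: (@solution_prod (contract_edge e) _ _ (cw w) _ soly); first exact: uE.
  move=> f; rewrite -/(E w).
  rewrite memE inE /= /contract_ends; apply/idP/imsetP => [wf|[w' w'f]].
    by exists w.
  rewrite /cw /contract_vertex insubT; case: insubP => // w'' _ w''E [/(congr1 val)] /= ww.
  by rewrite ww w''E.
rewrite xe //; move: we; rewrite eE !inE => /orP[]/eqP->; first exact: PP.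
rewrite /P -big_cat; apply: (@solution_prod (contract_edge e) _ _ None _ soly).
  rewrite cat_uniq !uE andbT /=; apply/hasPn => f; rewrite !memE => vf.
  apply: contra (valP f) => uf; apply/eqP.
  exact: etrans (ends_mem2 uv uf vf) (esym eE).
move=> f; rewrite mem_cat !memE inE /= /contract_ends.
apply/orP/imsetP => [[wf|wf]|[w' w'f]].
- by exists u => //; apply/esym/(cv u).
- by exists v => //; apply/esym/(cv v).
- rewrite /contract_vertex; case: insubP => // /negbNE w'e.
  by move: w'e; rewrite {1}eE !inE => /orP[]/eqP wE _; [left|right]; rewrite -wE; apply: w'f.
Qed.

Lemma minor_finite_type (H G : mgraph) : minor H G -> finite_type G -> finite_type H.
Proof.
elim=> {G} [G iso|G e _ IH finG|G v _ IH finG|G e _ IH finG].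
- exact: finite_type_miso.
- exact/IH/finite_type_delete_edge.
- exact/IH/finite_type_delete_vertex.
- exact/IH/finite_type_contract_edge.
Qed.

(** * Two groups: [K_5] and weakly commuting elementary abelian 2-groups *)

(* Read off the drawing of K_5 with a single crossing, that of y_ad and y_ce. *)
Lemma K5_commute (H : groupType) (yab yac yad yae ybc ybd ybe ycd yce yde : H) :
  yab * yab = 1 -> yac * yac = 1 -> yad * yad = 1 -> yce * yce = 1 ->
  ybc * ybc = 1 -> ybd * ybd = 1 -> ybe * ybe = 1 ->
  yab = yac * yad * yae -> yab = ybc * ybd * ybe ->
  yae * ybe = yce * yde -> yad * yde * ybd = ycd -> yac = yce * ycd * ybc ->
  commute yad yce.
Proof.
move=> ab2 ac2 ad2 ce2 bc2 bd2 be2 va vb ve vd vc.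
have e1 : yac * yad * (yae * ybe) * ybd * ybc = 1.
  rewrite !mulgA -va vb -[_ * ybe * ybe]mulgA be2 mulg1.
  by rewrite -[_ * ybd * ybd]mulgA bd2 mulg1 bc2.
(* Expanding the second [yac] at the vertices c and d, the commutator of the crossing pair cancels
   down to the word of [e1], by the relation at e. *)
have e2 : yac * (yad * yce * yad * yce) * yac = 1.
  rewrite {2}vc -vd -[RHS]e1 ve -!mulgA; congr (_ * (_ * (_ * _))).
  by rewrite [yce * (yce * _)]mulgA ce2 mul1g [yad * (yad * _)]mulgA ad2 mul1g.
have e3 : yad * yce * yad * yce = 1.
  apply: (mulgI yac); apply: (mulIg yac).
  by rewrite e2 mulg1 ac2.
apply: (mulIg yad); apply: (mulIg yce).
by rewrite e3 -[yce * yad * yad]mulgA ad2 mulg1 ce2.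
Qed.

(** The last clause is an induction principle over the list: closure under conjugation by outside
    elements then needs checking on the generators only. *)
Lemma fin_gen_commuting (I : finType) (H : groupType) (x : I -> H) :
  (forall i, x i * x i = 1) -> (forall i j, commute (x i) (x j)) ->
  exists s : seq H, [/\ 1 \in s, forall h i, h \in s -> h * x i \in s
    & forall P : H -> Prop, P 1 -> (forall h i, P h -> P (h * x i)) ->
      forall h, h \in s -> P h].
Proof.
move=> xx xC.
suff [s [s1 sM sP]] : exists s : seq H, [/\ 1 \in s,
    forall h i, i \in enum I -> h \in s -> h * x i \in s
    & forall P : H -> Prop, P 1 -> (forall h i, P h -> P (h * x i)) ->
      forall h, h \in s -> P h].
  by exists s; split=> // h i; apply: sM; rewrite mem_enum.
elim: (enum I) => [|i l [s [s1 sM sP]]].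
  by exists [:: 1]; split; rewrite ?mem_head // => P P1 _ h; rewrite inE => /eqP ->.
exists (s ++ [seq h * x i | h <- s]); split.
- by rewrite mem_cat s1.
- move=> h j; rewrite inE mem_cat => /orP[/eqP->|jl] /orP[hs|/mapP[k ks ->]].
  + by rewrite mem_cat (map_f (fun k => k * x i)) ?orbT.
  + by rewrite -mulgA xx mulg1 mem_cat ks.
  + by rewrite mem_cat sM.
  + by rewrite -mulgA xC mulgA mem_cat (map_f (fun k => k * x i)) ?orbT ?sM.
- move=> P P1 PM h; rewrite mem_cat => /orP[|/mapP[k ks ->]]; first exact: sP.
  exact/PM/(sP P P1 PM).
Qed.

(** * Sidki's weak commutativity construction for elementary abelian 2-groups *)

Section WeakCommutativity.
Variables (V : finType) (add : V -> V -> V) (H : groupType) (a b : V -> H).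
Hypothesis aD : forall u v, a (add u v) = a u * a v.
Hypothesis bD : forall u v, b (add u v) = b u * b v.
Hypothesis aa : forall u, a u * a u = 1.
Hypothesis bb : forall u, b u * b u = 1.
Hypothesis ab : forall u, commute (a u) (b u).

Let aC u v : a u * a v = a v * a u.
Proof.
apply: (mulIg (a u)); apply: (mulIg (a v)).
by rewrite -[LHS]mulgA -aD aa -[a v * a u * a u]mulgA aa mulg1 aa.
Qed.

Let bC u v : b u * b v = b v * b u.
Proof.
apply: (mulIg (b u)); apply: (mulIg (b v)).
by rewrite -[LHS]mulgA -bD bb -[b v * b u * b u]mulgA bb mulg1 bb.
Qed.

Let aK u h : a u * (a u * h) = h. Proof. by rewrite mulgA aa mul1g. Qed.
Let bK u h : b u * (b u * h) = h. Proof. by rewrite mulgA bb mul1g. Qed.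
Let aCA u v h : a u * (a v * h) = a v * (a u * h).
Proof. by rewrite mulgA aC -mulgA. Qed.
Let bCA u v h : b u * (b v * h) = b v * (b u * h).
Proof. by rewrite mulgA bC -mulgA. Qed.
Let abA u h : a u * (b u * h) = b u * (a u * h).
Proof. by rewrite mulgA ab -mulgA. Qed.

(* Locked, lest associativity be rewritten inside it. *)
Definition weak_comm u v := locked (a u * (b v * (a u * b v))).
Local Notation D := weak_comm.

Let D0 u v : D u v = a u * (b v * (a u * b v)).
Proof. by rewrite /weak_comm -lock. Qed.

(** [D u v] is the commutator of the involutions [a u] and [b v]. Expanding the commutation of [a]
    and [b] at [add u v] shows that it survives exchanging [a] with [b]. *)
Let DE u v : D u v = b u * (a v * (b u * a v)).
Proof.
have R : a v * (b u * (a u * b v)) = b v * (a u * (b u * a v)).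
  rewrite -abA aCA; have := ab (add u v); rewrite aD bD /commute -!mulgA => ->.
  by rewrite bCA -abA.
have {}R : a u * b v = b u * (a v * (b v * (a u * (b u * a v)))).
  by rewrite -R aK bK.
rewrite !D0 mulgA {1}R -!mulgA; congr (_ * (_ * _)).
by rewrite [a v * (a u * _)]aCA -abA aK bCA [a v * b v]ab bK.
Qed.

Let DC u v : D u v = D v u.
Proof.
have -> : D u v = a v * (D u v * a v).
  by rewrite !D0 -!mulgA -[b v * a v]ab [a u * (a v * _)]aCA -abA aCA aK.
by rewrite DE -!mulgA aa mulg1.
Qed.

Let DD u v : D u v * D u v = 1.
Proof. by rewrite [X in X * _]DC [X in _ * X]DE !D0 -!mulgA bK aK bK aa. Qed.

(** By [DE], [D u v] is the commutator of [b u] with [a v], and this is the product rule for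
    commutators. [bDb] has the same right-hand side, so [a w] and [b w] act alike on all [D u v]. *)
Let aDa u v w : a w * (D u v * a w) = D u w * D u (add v w).
Proof.
rewrite [D u w]DC [D u (add v w)]DE [D u v]DE !D0 aD -!mulgA bK.
by rewrite [a w * (a v * _)]aCA aK.
Qed.

Let bDb u v w : b w * (D u v * b w) = D u w * D u (add v w).
Proof.
rewrite [D u w]DC [D w u]DE !D0 bD -!mulgA.
by rewrite aK [b w * (b v * _)]bCA bK.
Qed.

Let ab_conj u v z : b z * (D u v * b z) = a z * (D u v * a z).
Proof. by rewrite aDa bDb. Qed.

Let ab_conj2 u v w z : b z * (D u v * (D u w * b z)) = a z * (D u v * (D u w * a z)).
Proof.
have bE : b z * (D u v * (D u w * b z)) =
    (b z * (D u v * b z)) * (b z * (D u w * b z)) by rewrite -!mulgA bK.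
have aE : a z * (D u v * (D u w * a z)) =
    (a z * (D u v * a z)) * (a z * (D u w * a z)) by rewrite -!mulgA aK.
by rewrite bE aE !ab_conj.
Qed.

(** Conjugation by [b z] may be replaced by conjugation by [a z] on these elements, so [D w z] acts
    on them as the commutator of [a w] and [a z], which is trivial. *)
Let D_comm u v w z : commute (D u v) (D w z).
Proof.
suff e : a w * (b z * (a w * (b z * (D u v * (b z * (a w * (b z * a w))))))) = D u v.
  have DwzV : D w z = b z * (a w * (b z * a w)) by rewrite DC DE.
  have e' : D w z * (D u v * D w z) = D u v by rewrite {2}DwzV [X in X * (_ * _) = _]D0 -!mulgA.
  by apply: (mulgI (D w z)); rewrite e' mulgA DD mul1g.
have -> : b z * (D u v * (b z * (a w * (b z * a w)))) =
    a z * (D u v * (a z * (a w * (b z * a w)))).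
  by have := ab_conj u v z; move/(congr1 (fun h => h * (a w * (b z * a w)))); rewrite -!mulgA.
have e1 : a w * (a z * (D u v * (a z * a w))) = D u (add z w) * D u (add v (add z w)).
  by have := aDa u v (add z w); rewrite aD -!mulgA aCA => <-.
have -> : a w * (a z * (D u v * (a z * (a w * (b z * a w))))) =
    D u (add z w) * (D u (add v (add z w)) * (b z * a w)).
  by move/(congr1 (fun h => h * (b z * a w))): e1; rewrite -!mulgA.
have -> : b z * (D u (add z w) * (D u (add v (add z w)) * (b z * a w))) =
    a z * (D u (add z w) * (D u (add v (add z w)) * (a z * a w))).
  by have := ab_conj2 u (add z w) (add v (add z w)) z;
     move/(congr1 (fun h => h * a w)); rewrite -!mulgA.
have -> : D u (add z w) * (D u (add v (add z w)) * (a z * a w)) =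
    a w * (a z * (D u v * (a z * (a w * (a z * a w))))).
  by move/(congr1 (fun h => h * (a z * a w))): e1; rewrite -!mulgA.
by rewrite [a z * (a w * _)]aCA !aK [a z * (a w * _)]aCA aK aa mulg1.
Qed.

(** The [D u v] are commuting involutions, finitely many, normalised by all [a w] and [b w]. Modulo
    the finite list [t] they generate, [a] and [b] commute, whence the normal form [a u * (b v * h)]
    with [h] in [t]. *)
Lemma weak_commutativity_fin_gen :
  exists s : seq H, [/\ 1 \in s, forall h u, h \in s -> h * a u \in s
    & forall h u, h \in s -> h * b u \in s].
Proof.
have [t [t1 tM tP]] := @fin_gen_commuting _ _ (fun p : V * V => D p.1 p.2)
  (fun p => DD p.1 p.2) (fun p q => D_comm p.1 p.2 q.1 q.2).
have tD h u v : h \in t -> h * D u v \in t by move=> ht; apply: (tM h (u, v)).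
have Dt u v h : h \in t -> D u v * h \in t.
  apply: (tP (fun h => D u v * h \in t)) => [|k p kt]; last by rewrite mulgA tD.
  by rewrite mulg1 -[D u v]mul1g tD.
have at_ w h : h \in t -> a w * (h * a w) \in t.
  apply: (tP (fun h => a w * (h * a w) \in t)) => [|k p kt].
    by rewrite mul1g aa.
  have -> : a w * (k * D p.1 p.2 * a w) = a w * (k * a w) * (a w * (D p.1 p.2 * a w)).
    by rewrite -!mulgA aK.
  by rewrite aDa mulgA !tD.
have bt w h : h \in t -> b w * (h * b w) \in t.
  apply: (tP (fun h => b w * (h * b w) \in t)) => [|k p kt].
    by rewrite mul1g bb.
  have -> : b w * (k * D p.1 p.2 * b w) = b w * (k * b w) * (b w * (D p.1 p.2 * b w)).
    by rewrite -!mulgA bK.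
  by rewrite bDb mulgA !tD.
pose elt (p : V * V) h := a p.1 * (b p.2 * h).
pose s := [seq elt p h | p <- enum {: V * V}, h <- t].
have sI p h : h \in t -> elt p h \in s.
  by move=> ht; apply/allpairsP; exists (p, h); rewrite /= mem_enum.
have s_ind (P : H -> Prop) : (forall u v h, h \in t -> P (a u * (b v * h))) ->
    forall h, h \in s -> P h.
  by move=> PI h /allpairsP[[p k] /= [_ kt ->]]; apply: PI.
have [V0|] := pickP (@predT V); last first.
  by move=> V0; exists [:: 1]; split=> [|h u|h u]; rewrite ?mem_head //; have := V0 u.
(* [add] is not assumed to have a neutral element; [o] serves as one, because [a] and [b] are
   trivial on it. *)
move=> _; pose o := add V0 V0; have ao : a o = 1 by rewrite aD aa.
have bo : b o = 1 by rewrite bD bb.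
exists s; split.
- by have := sI (o, o) 1 t1; rewrite /elt /= ao bo !mul1g.
- move=> k w; apply: (s_ind (fun k => k * a w \in s)) => u v h ht.
  have -> : a u * (b v * h) * a w = a (add u w) * (b v * (D v w * (a w * (h * a w)))).
    by rewrite aD DE -!mulgA bK !aK.
  by apply: (sI (add u w, v)); apply/Dt/at_.
- move=> k w; apply: (s_ind (fun k => k * b w \in s)) => u v h ht.
  have -> : a u * (b v * h) * b w = a u * (b (add v w) * (b w * (h * b w))).
    by rewrite bD -!mulgA bK.
  by apply: (sI (u, add v w)); apply: bt.
Qed.

End WeakCommutativity.

(** * Three rows of five involutions: the group of [K_{3,5}] *)

Section K35.
Variables (H : groupType) (a b c : 'I_5 -> H).
Hypothesis aa : forall i, a i * a i = 1.
Hypothesis bb : forall i, b i * b i = 1.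
Hypothesis aC : forall i j, commute (a i) (a j).
Hypothesis bC : forall i j, commute (b i) (b j).
Hypothesis cC : forall i j, commute (c i) (c j).
Hypothesis ab : forall i, commute (a i) (b i).
Hypothesis cE : forall i, c i = a i * b i.
Hypothesis a1 : \prod_(i < 5) a i = 1.
Hypothesis b1 : \prod_(i < 5) b i = 1.

Let V := {ffun 'I_5 -> bool}.
Let add (u v : V) : V := [ffun i => u i (+) v i].
Let ext (x : 'I_5 -> H) (v : V) := \prod_(i < 5) (if v i then x i else 1).

Let ext_add (x : 'I_5 -> H) u v : (forall i, x i * x i = 1) ->
  (forall i j, commute (x i) (x j)) -> ext x (add u v) = ext x u * ext x v.
Proof.
move=> xx xC; rewrite /ext -prodgM_commute; last first.
  move=> i j _ _; case: (u i) (v j) => -[];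
  by [apply: xC|apply: commute1|apply/commute_sym/commute1].
apply: eq_bigr => i _; rewrite ffunE; case: (u i) (v i) => -[];
by rewrite /= ?xx ?mulg1 ?mul1g.
Qed.

Let ext_sq (x : 'I_5 -> H) u : (forall i, x i * x i = 1) ->
  (forall i j, commute (x i) (x j)) -> ext x u * ext x u = 1.
Proof.
move=> xx xC; rewrite -ext_add //; apply: big1 => i _.
by rewrite ffunE addbb.
Qed.

Let ext_compl (x : 'I_5 -> H) (v : V) : (forall i, x i * x i = 1) ->
  (forall i j, commute (x i) (x j)) -> \prod_(i < 5) x i = 1 ->
  ext x v = ext x [ffun i => ~~ v i].
Proof.
move=> xx xC x1; apply: (mulIg (ext x [ffun i => ~~ v i])).
rewrite ext_sq // -ext_add //; rewrite -[RHS]x1.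
by apply: eq_bigr => i _; rewrite !ffunE; case: (v i).
Qed.

(** Commutation of [c i] with [c j], rewritten through [c i = a i * b i], is what yields commutation
    at the sum of two basis vectors of F_2^5; at one basis vector it is [ab]. *)
Let pair i j : commute (a i * a j) (b i * b j).
Proof.
have e : b i * (a i * a j) * b j = b j * (a i * a j) * b i.
  have := cC i j; rewrite !cE /commute {1}(ab i) {2}(ab j) !mulgA => ->.
  by rewrite -[b j * a j * a i]mulgA (aC j i) mulgA.
have {}e : a i * a j * (b j * b i) = b i * b j * (a i * a j).
  apply: (mulgI (b i)); rewrite !mulgA bb mul1g -[b i * a i * a j]mulgA e.
  by rewrite -[_ * b i * b i]mulgA bb mulg1 mulgA.
by rewrite /commute -e (bC j i).
Qed.

Let small (v : V) : (\sum_(i < 5) v i <= 2)%N -> commute (ext a v) (ext b v).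
Proof.
rewrite /ext !big_ord_recl !big_ord0.
case: (v _) => /=; case: (v _) => /=; case: (v _) => /=; case: (v _) => /=;
  case: (v _) => //= _; rewrite !(mulg1, mul1g);
  by [apply: ab|apply: pair].
Qed.

(* Every subset of the five indices or its complement has at most two elements. *)
Let weak (v : V) : commute (ext a v) (ext b v).
Proof.
have [/small //|big] := leqP (\sum_(i < 5) v i) 2.
rewrite (ext_compl v aa aC a1) (ext_compl v bb bC b1); apply: small.
have : \sum_(i < 5) (v i + [ffun j => ~~ v j] i)%N = 5.
  by rewrite (eq_bigr (fun=> 1%N)) ?sum_nat_const ?card_ord // => i _; rewrite ffunE; case: (v i).
rewrite big_split /= => e; rewrite -(leq_add2l (\sum_(i < 5) v i)) e.
by rewrite -[5]/(3 + 2)%N leq_add2r.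
Qed.

Lemma K35_fin_gen : exists s : seq H, [/\ 1 \in s,
  forall h i, h \in s -> h * a i \in s, forall h i, h \in s -> h * b i \in s
  & forall h i, h \in s -> h * c i \in s].
Proof.
have [s [s1 sa sb]] := @weak_commutativity_fin_gen V add H (ext a) (ext b)
  (fun u v => ext_add u v aa aC) (fun u v => ext_add u v bb bC)
  (fun u => ext_sq u aa aC) (fun u => ext_sq u bb bC) weak.
have single x i : x i = ext x [ffun j => j == i].
  rewrite /ext (eq_bigr (fun j => if j == i then x j else 1)) => [|j _].
    by rewrite -big_mkcond big_pred1_eq.
  by rewrite ffunE.
have sA h i : h \in s -> h * a i \in s by rewrite (single a); apply: sa.
have sB h i : h \in s -> h * b i \in s by rewrite (single b); apply: sb.
by exists s; split=> // h i hs; rewrite cE mulgA sB // sA.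
Qed.
End K35.

(** * Two infinite incidence groups *)

Lemma foldr_perm_commuting (I : eqType) (T : Type) (f : I -> T -> T) (s t : seq I) z :
  {in s &, forall i j z, f i (f j z) = f j (f i z)} -> perm_eq s t ->
  foldr f z s = foldr f z t.
Proof.
elim: s t => [|i s IHs] t fC; first by rewrite perm_sym => /perm_nilP ->.
move=> est; have it : i \in t by rewrite -(perm_mem est) mem_head.
case/splitPr: it est => t1 t2 est.
have est' : perm_eq s (t1 ++ t2).
  by rewrite -(perm_cons i) (permPl est) -cat_cons perm_catC /= perm_cons perm_catC.
have sub j : j \in s -> j \in i :: s by rewrite inE orbC => ->.
rewrite /= (IHs (t1 ++ t2)) //; last by move=> j k /sub js /sub ks; apply: fC.
rewrite !foldr_cat /=.
have: {subset t1 <= i :: s} by move=> j jt; rewrite (perm_mem est) mem_cat jt.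
elim: t1 {est est' IHs} => //= j t1 IHt tS; rewrite -IHt.
  by apply: fC; rewrite ?mem_head ?tS ?mem_head.
by move=> k kt; apply: tS; rewrite inE kt orbT.
Qed.

Section Action.
Variables (G : mgraph) (T : eqType) (f : edge G -> T -> T).
Hypothesis ff : forall e t, f e (f e t) = t.
Hypothesis fC : forall v e e' t, e \in incident v -> e' \in incident v ->
  f e (f e' t) = f e' (f e t).
(** The maps at one vertex commute, so the triviality of their product may be checked in whichever
    order is convenient to compute. *)
Hypothesis fv : forall v, exists2 s,
  perm_eq s (enum (incident v)) & forall t, foldr f t s = t.

Let act (w : word (edge G)) (t : T) := foldr (fun l => f l.1) t w.

Lemma word_eq_act u v : word_eq (@uncoloured_rel G) u v -> act u =1 act v.
Proof.
elim=> {u v} [u v|l t|//|u v _ IH t|u v w _ uv _ vw t|u u' v v' _ eu _ ev t].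
- case=> [e|v' e e' ev e'v|v'] t; rewrite /act /=; first exact: ff.
    exact: fC ev e'v.
  rewrite foldr_map.
  have [s sE s1] := fv v'; rewrite -[RHS]s1; apply: foldr_perm_commuting.
    by move=> e e'; rewrite !mem_enum => ev e'v z; apply: fC ev e'v.
  by rewrite perm_sym.
- by rewrite /act /= ff.
- by rewrite IH.
- by rewrite uv vw.
- by rewrite /act !foldr_cat -/(act _ _) -[X in act u X]/(act v t) ev; apply: eu.
Qed.

(** Words act on [T] compatibly with the relations, so a finite list of classes gives finitely many
    images of [t], while the powers of the word [p] already give infinitely many. *)
Lemma infinite_orbit_finite_type (p : seq (edge G)) (t : T) :
  injective (fun n => iter n (fun z => foldr f z p) t) -> ~ finite_type G.
Proof.
move=> inj finG; have [s [s1 sM]] := finG _ _ (uncoloured_solution G).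
have sP q h : h \in s -> h * \prod_(e <- q) pgen (@uncoloured_rel G) e \in s.
  elim: q h => [|e q IHq] h hs; first by rewrite big_nil mulg1.
  by rewrite big_cons mulgA; apply/IHq/sM.
pose w n : word (edge G) := flatten (nseq n [seq (e, false) | e <- p]).
have ws n : word_eval (pgen (@uncoloured_rel G)) (w n) \in s.
  elim: n => [|n IHn]; first by rewrite /word_eval big_nil.
  have -> : w n.+1 = w n ++ [seq (e, false) | e <- p].
    by rewrite /w -addn1 nseqD flatten_cat /= cats0.
  by rewrite word_eval_cat word_eval_gens; apply: sP.
have actw n : act (w n) t = iter n (fun z => foldr f z p) t.
  elim: n => //= n IHn; rewrite {1}/w /= /act foldr_cat -/(act _ t) IHn.
  by rewrite foldr_map.
pose vals := [seq act (repr q) t | q <- s].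
have wv n : iter n (fun z => foldr f z p) t \in vals.
  rewrite -actw; apply/mapP; exists (word_eval (pgen (@uncoloured_rel G)) (w n)) => //.
  by apply/esym/word_eq_act; rewrite word_eval_pgen; apply: repr_word_eq.
have := @uniq_leq_size _ [seq iter n (fun z => foldr f z p) t | n <- iota 0 (size vals).+1] vals.
rewrite map_inj_uniq // iota_uniq size_map size_iota ltnn => /(_ isT) sub.
suff: false by []; apply: sub => x /mapP[n _ ->]; exact: wv.
Qed.

End Action.

(** The two parallel edges of each copy carry the same reflection of the integers, [- t] on one copy
    and [1 - t] on the other. These generate the infinite dihedral group and their composite is a
    translation. *)
Lemma C2_C2_infinite : ~ finite_type (disj_union C2 C2).
Proof.
pose f (e : edge (disj_union C2 C2)) (t : int) : int :=
  if e is inl _ then (- t)%R else (1 - t)%R.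
have ff e t : f e (f e t) = t by case: e => e /=; lia.
apply: (@infinite_orbit_finite_type _ _ f ff _ _ [:: inl ord0; inr ord0] 0%R).
- move=> v e e' t; rewrite !inE.
  by case: v e e' => v [e|e] [e'|e'] //= h h'; first [by case/imsetP: h|by case/imsetP: h'].
- case=> v; [exists [seq inl e | e <- enum 'I_2]|exists [seq inr e | e <- enum 'I_2]].
  + apply: uniq_perm; [by rewrite map_inj_uniq ?enum_uniq // => ? ? []|exact: enum_uniq|move=> e].
    rewrite mem_enum inE; case: e => e /=.
      rewrite mem_imset; last by move=> ? ? [].
      by rewrite inE mem_map ?mem_enum // => ? ? [].
    by apply/mapP/imsetP => -[? _].
  + by move=> t; rewrite foldr_map -(foldr_map val (fun _ z => (- z)%R)) val_enum_ord /=; lia.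
  + apply: uniq_perm; [by rewrite map_inj_uniq ?enum_uniq // => ? ? []|exact: enum_uniq|move=> e].
    rewrite mem_enum inE; case: e => e /=.
      by apply/mapP/imsetP => -[? _].
    rewrite mem_imset; last by move=> ? ? [].
    by rewrite inE mem_map ?mem_enum // => ? ? [].
  + by move=> t; rewrite foldr_map -(foldr_map val (fun _ z => (1 - z)%R)) val_enum_ord /=; lia.
- have itE n : iter n (fun z => foldr f z [:: inl ord0; inr ord0]) 0%R = (- n%:Z)%R.
    by elim: n => // n IHn; rewrite iterS IHn /=; lia.
  by move=> m n; rewrite !itE => /GRing.oppr_inj [].
Qed.

Local Notation int4 := (int * int * int * int)%type.

(* Three commuting sign changes and three affine maps of Z^4 of which the k-th
   ones commute; doubling them fills the 3 x 6 array with trivial row products. *)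
Definition K36_sign (k : nat) (t : int4) : int4 :=
  let: (x, y, z, w) := t in
  match k with
  | 0 => (x, - y, z, - w)
  | 1 => (x, y, - z, - w)
  | _ => (- x, y, z, - w)
  end%R.

Definition K36_swap (k : nat) (t : int4) : int4 :=
  let: (x, y, z, w) := t in
  match k with
  | 0 => (1 - z, - w, 1 - x, - y)
  | 1 => (1 + y, x - 1, w, z)
  | _ => (w, z - 1, 1 + y, x)
  end%R.

Definition K36_act (i j : nat) (t : int4) : int4 :=
  match i with
  | 0 => K36_sign j./2 t
  | 1 => K36_swap j./2 t
  | _ => K36_sign j./2 (K36_swap j./2 t)
  end.

Lemma K36_infinite : ~ finite_type (complete_bipartite 3 6).
Proof.
pose f (e : edge (complete_bipartite 3 6)) : int4 -> int4 := K36_act e.1 e.2.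
have pairE (x y z w x' y' z' w' : int) : x = x' -> y = y' -> z = z' -> w = w' ->
  (x, y, z, w) = (x', y', z', w') by move=> -> -> -> ->.
have half (j : 'I_6) : [|| j./2 == 0, j./2 == 1 | j./2 == 2]%N.
  by case: j => -[|[|[|[|[|[|]]]]]].
have ff (e : edge (complete_bipartite 3 6)) t : f e (f e t) = t.
  case: e t => -[[|[|[|//]]] i3] j [[[x y] z] w]; rewrite /f /K36_act /=;
  by have /or3P[/eqP->|/eqP->|/eqP->] := half j; apply: pairE => /=; lia.
have fR (i : 'I_3) (j j' : 'I_6) t : f (i, j) (f (i, j') t) = f (i, j') (f (i, j) t).
  case: i t => -[|[|[|//]]] i3 [[[x y] z] w]; rewrite /f /K36_act /=;
  by have /or3P[/eqP->|/eqP->|/eqP->] := half j; have /or3P[/eqP->|/eqP->|/eqP->] := half j';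
    apply: pairE => /=; lia.
have fK (i i' : 'I_3) (j : 'I_6) t : f (i, j) (f (i', j) t) = f (i', j) (f (i, j) t).
  case: i i' t => -[|[|[|//]]] i3 -[[|[|[|//]]] i3'] [[[x y] z] w];
  rewrite /f /K36_act /=;
  by have /or3P[/eqP->|/eqP->|/eqP->] := half j; apply: pairE => /=; lia.
pose o3 (k : nat) : 'I_3 := inord k; pose o6 (k : nat) : 'I_6 := inord k.
(* On the third coordinate axis, [K36_sign 2] conjugated by [K36_swap 0] is the reflection [2 - z];
   followed by the reflection [- z] of [K36_sign 1] it translates by -2. [foldr] applies the last
   letter first. *)
apply: (@infinite_orbit_finite_type _ _ f ff _ _
  [:: (o3 0, o6 0); (o3 0, o6 2); (o3 1, o6 0); (o3 0, o6 4); (o3 1, o6 0)]%N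
  (0, 0, 0, 0)%R).
- move=> v [i j] [i' j'] t; rewrite !inE; case: v => v.
    by move=> /orP[]/eqP // [<-] /orP[]/eqP // [<-]; apply: fR.
  by move=> /orP[]/eqP // [<-] /orP[]/eqP // [<-]; apply: fK.
- case=> v; [exists [seq (v, j) | j <- enum 'I_6]|exists [seq (i, v) | i <- enum 'I_3]].
  + apply: uniq_perm; [by rewrite map_inj_uniq ?enum_uniq // => ? ? []|exact: enum_uniq|move=> [i j]].
    rewrite mem_enum !inE; apply/mapP/orP => [[j' _ [-> _]]|[]/eqP // [->]]; first by left.
    by exists j; rewrite ?mem_enum.
  + move=> t; rewrite foldr_map -(foldr_map val (K36_act v)) val_enum_ord.
    case: v t => -[|[|[|//]]] i3 [[[x y] z] w] /=; apply: pairE => /=; lia.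
  + apply: uniq_perm; [by rewrite map_inj_uniq ?enum_uniq // => ? ? []|exact: enum_uniq|move=> [i j]].
    rewrite mem_enum !inE; apply/mapP/orP => [[j' _ [_ ->]]|[]/eqP // [->]]; first by right.
    by exists i; rewrite ?mem_enum.
  + move=> t; rewrite foldr_map -(foldr_map val (K36_act^~ v)) val_enum_ord.
    case: t => [[[x y] z] w]; rewrite /= /K36_act /=.
    by have /or3P[/eqP->|/eqP->|/eqP->] := half v; apply: pairE => /=; lia.
- set p := [:: _; _; _; _; _].
  have itE n : iter n (fun t => foldr f t p) (0, 0, 0, 0)%R = (0, 0, - (2 * n)%N%:Z, 0)%R.
    elim: n => // n IHn; rewrite iterS IHn /p /f /= /K36_act !inordK //=.
    by apply: pairE; lia.
  by move=> m n; rewrite !itE => -[]; lia.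
Qed.

(** * Disjoint cycles and the minor [C_2 + C_2] *)

Lemma inj_surj_bij (A B : finType) (f : A -> B) :
  injective f -> (forall y, y \in codom f) -> bijective f.
Proof.
move=> fI fS; apply: inj_card_bij => //.
by rewrite -(card_codom fI); apply: subset_leq_card; apply/subsetP => y _; apply: fS.
Qed.

Lemma embed_minor (H G : mgraph) (f : vertex H -> vertex G) (g : edge H -> edge G) :
  injective f -> injective g -> (forall e, ends (g e) = f @: ends e) -> minor H G.
Proof.
have [n] := ubnP (#|vertex G| + #|edge G|)%N.
elim: n G f g => // n IHn G f g Gn fI gI fg.
have [/forallP gS|] := boolP [forall e, e \in codom g]; last first.
  rewrite negb_forall => /existsP[e0 e0g].
  have ne e : g e != e0 by apply: contraNneq e0g => <-; apply: codom_f.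
  apply: (@minor_delete_edge _ _ e0).
  apply: (IHn (delete_edge e0) f (fun e => exist _ (g e) (ne e))) => //.
    rewrite /= card_sig; apply: leq_trans (_ : _ <= #|vertex G| + #|edge G|)%N _ => //.
    rewrite ltn_add2l; apply: proper_card; apply/properP; split; first exact/subsetP.
    by exists e0; rewrite // !inE eqxx.
  by move=> e e' [/gI].
have [/forallP fS|] := boolP [forall v, v \in codom f]; last first.
  rewrite negb_forall => /existsP[v0 v0f].
  have nv v : f v != v0 by apply: contraNneq v0f => <-; apply: codom_f.
  have ne e : v0 \notin ends (g e).
    by rewrite fg; apply/imsetP => -[v _ v0E]; have := nv v; rewrite v0E eqxx.
  apply: (@minor_delete_vertex _ _ v0).
  apply: (IHn (delete_vertex v0) (fun v => exist _ (f v) (nv v))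
                                (fun e => exist _ (g e) (ne e))).
  - rewrite /= !card_sig; apply: leq_trans (_ : _ <= #|vertex G| + #|edge G|)%N _ => //.
    rewrite -addSn leq_add ?max_card //; apply: proper_card; apply/properP.
    by split; [exact/subsetP|exists v0; rewrite // !inE eqxx].
  - by move=> v v' [/fI].
  - by move=> e e' [/gI].
  - move=> e; apply/setP => w; rewrite /= /del_vertex_ends !inE /= fg.
    apply/imsetP/imsetP => [[v ve wE]|[v ve ->]]; last by exists v.
    by exists v => //; apply: val_inj.
by apply: minor_iso; exists f, g; split=> //; apply: inj_surj_bij.
Qed.

(** Edges rather than neighbours are counted, so a pair of parallel edges is already a core, being a
    cycle of length 2. *)
Definition mcore (G : mgraph) (S : {set vertex G}) : Prop :=
  S != set0 /\ forall v, v \in S -> exists e f : edge G,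
    [/\ e != f, v \in ends e, v \in ends f, ends e \subset S & ends f \subset S].

(** The merged vertex inherits one further edge from each end of [e]. The two are distinct, since an
    edge through both ends would be parallel to [e]. *)
Lemma contract_mcore (G : mgraph) (e : edge G) (S : {set vertex G}) :
  mcore S -> (forall f, ends f = ends e -> f = e) ->
  ends e \subset S \/ [disjoint ends e & S] ->
  @mcore (contract_edge e) (contract_vertex e @: S).
Proof.
move=> [S0 cS] par eS; split.
  have [v vS] := set0Pn _ S0.
  by apply/set0Pn; exists (contract_vertex e v); apply: imset_f.
have lift f : f != e -> ends f != ends e by apply: contraNneq => /par->.
pose sub f (fe : f != e) : edge (contract_edge e) := exist _ f (lift f fe).
have subS f (fe : f != e) : ends f \subset S ->
    ends (sub f fe) \subset contract_vertex e @: S by move=> fS; apply: imsetS.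
have subv f (fe : f != e) v : v \in ends f -> contract_vertex e v \in ends (sub f fe).
  by move=> vf; apply: imset_f.
have other v : v \in S -> exists f, [/\ f != e, v \in ends f & ends f \subset S].
  move=> vS; have [f [g [fg vf vg fS gS]]] := cS v vS.
  have [fe|fe] := eqVneq f e; last by exists f.
  by exists g; split; rewrite // -fe eq_sym.
move=> _ /imsetP[v vS ->]; have [ve|ve] := boolP (v \in ends e).
  have {}eS : ends e \subset S.
    by case: eS => // dS; have := disjointFr dS ve; rewrite vS.
  have [p [q [pq eE]]] := ends_pair e.
  have pe : p \in ends e by rewrite eE set21.
  have qe : q \in ends e by rewrite eE set22.
  have cN w : w \in ends e -> contract_vertex e w = contract_vertex e v.
    by move=> we; rewrite /contract_vertex !insubF //; apply/negbF.
  have [f [fe pf fS]] := other p (subsetP eS _ pe).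
  have [g [ge qg gS]] := other q (subsetP eS _ qe).
  exists (sub f fe), (sub g ge); split; rewrite ?subS //.
  - apply/eqP => -[fg]; case/eqP: (fe); apply: par.
    by rewrite (ends_mem2 pq) ?eE // fg.
  - by rewrite -(cN p) // subv.
  - by rewrite -(cN q) // subv.
have [f [g [fg vf vg fS gS]]] := cS v vS.
have fe : f != e by apply: contraNneq ve => <-.
have ge : g != e by apply: contraNneq ve => <-.
exists (sub f fe), (sub g ge); by split; rewrite ?subS ?subv.
Qed.

Lemma mcore_parallel (G : mgraph) (S : {set vertex G}) :
  mcore S -> (forall e : edge G, ends e \subset S -> exists2 f, f != e & ends f = ends e) ->
  exists p q (e f : edge G), [/\ p \in S, q \in S & p != q] /\
    [/\ e != f, ends e = [set p; q] & ends f = [set p; q]].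
Proof.
move=> [S0 cS] par; have [v vS] := set0Pn _ S0.
have [e [_ [_ _ _ eS _]]] := cS v vS; have [f fe fE] := par e eS.
have [p [q [pq eE]]] := ends_pair e; exists p, q, e, f.
split; split=> //; first by apply: (subsetP eS); rewrite eE set21.
- by apply: (subsetP eS); rewrite eE set22.
- by rewrite eq_sym.
- by rewrite fE.
Qed.

(** Edges inside [S] or [T] without a parallel are contracted, which preserves both cores and their
    disjointness. Once none is left, each core contains a pair of parallel edges, and the two pairs
    form an embedded [C_2 + C_2]. *)
Lemma disjoint_mcores_minor (G : mgraph) (S T : {set vertex G}) :
  mcore S -> mcore T -> [disjoint S & T] -> minor (disj_union C2 C2) G.
Proof.
have [n] := ubnP #|edge G|; elim: n G S T => // n IHn G S T Gn cS cT dST.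
have contract (A B : {set vertex G}) (e : edge G) : mcore A -> mcore B ->
    [disjoint A & B] -> ends e \subset A -> (forall f, ends f = ends e -> f = e) ->
    minor (disj_union C2 C2) G.
  move=> cA cB dAB eA par; apply: (@minor_contract_edge _ _ e).
  have deB : [disjoint ends e & B] by apply: disjointWl dAB.
  apply: (IHn (contract_edge e) (contract_vertex e @: A) (contract_vertex e @: B)).
  - rewrite /= card_sig; apply: leq_trans (_ : _ <= #|edge G|)%N _ => //.
    apply: proper_card; apply/properP; split; first exact/subsetP.
    by exists e; rewrite // !inE eqxx.
  - by apply: contract_mcore => //; left.
  - by apply: contract_mcore => //; right.
  - rewrite -setI_eq0; apply/eqP/setP => w; rewrite in_set0 in_setI.
    apply/negP => /andP[/imsetP[x xA ->] /imsetP[y yB]].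
    have ye : y \notin ends e by apply/negP => ye; have := disjointFr deB ye; rewrite yB.
    rewrite /contract_vertex [in RHS]insubT; case: insubP => // z _ zE [/(congr1 val)] /= zy.
    have xy : x = y by rewrite -zE; exact: zy.
    by have := disjointFr dAB xA; rewrite xy yB.
have [[e [eS par]]|nS] := pselect (exists e : edge G,
    ends e \subset S /\ forall f, ends f = ends e -> f = e).
  exact: contract cS cT dST eS par.
have [[e [eT par]]|nT] := pselect (exists e : edge G,
    ends e \subset T /\ forall f, ends f = ends e -> f = e).
  by apply: contract cT cS _ eT par; rewrite disjoint_sym.
have parS e : ends e \subset S -> exists2 f, f != e & ends f = ends e.
  move=> eS; apply: contrapT => nf; apply: nS; exists e; split=> // f fE.
  by apply/eqP; apply: contraPT nf => fe; apply; exists f.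
have parT e : ends e \subset T -> exists2 f, f != e & ends f = ends e.
  move=> eT; apply: contrapT => nf; apply: nT; exists e; split=> // f fE.
  by apply/eqP; apply: contraPT nf => fe; apply; exists f.
have [p [q [e [f [[pS qS pq] [ef eE fE]]]]]] := mcore_parallel cS parS.
have [p' [q' [e' [f' [[p'T q'T pq'] [ef' eE' fE']]]]]] := mcore_parallel cT parT.
have ST x y : x \in S -> y \in T -> x <> y.
  by move=> xS yT xy; have := disjointFr dST xS; rewrite xy yT.
pose vmap (v : vertex (disj_union C2 C2)) : vertex G :=
  match v with inl i => if i == ord0 then p else q | inr i => if i == ord0 then p' else q' end.
pose emap (v : edge (disj_union C2 C2)) : edge G :=
  match v with inl i => if i == ord0 then e else f | inr i => if i == ord0 then e' else f' end.
have I2 (i j : 'I_2) : (i == ord0) = (j == ord0) -> i = j.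
  by case: i j => -[|[|//]] ? [[|[|//]] ?] //= _; apply: val_inj.
have two (i : 'I_2) : i = ord0 \/ i = ord_max.
  by case: i => -[|[|//]] ?; [left|right]; apply: val_inj.
have img (A : finType) (h : 'I_2 -> A) : h @: [set: 'I_2] = [set h ord0; h ord_max].
  apply/setP => x; apply/imsetP/set2P => [[i _ ->]|[]->].
  - by case: (two i) => ->; [left|right].
  - by exists ord0.
  - by exists ord_max.
have eST x y : ends x = [set p; q] -> ends y = [set p'; q'] -> x <> y.
  move=> xE yE xy; apply: (ST p p) => //; have : p \in ends y by rewrite -xy xE set21.
  by rewrite yE => /set2P[]->.
apply: (@embed_minor (disj_union C2 C2) G vmap emap).
- case=> [i|i] [j|j] /=; case: (two i) (two j) => -> [] -> //= h;
  try (by move: pq pq'; rewrite h eqxx); exfalso; move: h;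
  by [apply: ST|move/esym; apply: ST].
- case=> [i|i] [j|j] /=; case: (two i) (two j) => -> [] -> //= h;
  try (by move: ef ef'; rewrite h eqxx); exfalso; move: h;
  by [apply: eST|move/esym; apply: eST].
- by case=> i /=; rewrite -imset_comp img; case: (two i) => ->.
Qed.

(** * Reductions *)

Section Reductions.
Variables (G : mgraph) (H : groupType) (x : edge G -> H).
Hypothesis solx : solution x.

Definition central (e : edge G) : Prop := forall f, commute (x e) (x f).

Lemma solution_factor v e : v \in ends e ->
  x e = \prod_(f <- rem e (enum (incident v))) x f.
Proof.
move=> ve; apply: (mulgI (x e)); rewrite (solution_sq solx).
rewrite -[LHS](@solution_prod _ _ x v (e :: rem e (enum (incident v)))) ?big_cons //.
  by rewrite /= rem_uniq ?enum_uniq // mem_rem_uniq ?enum_uniq // !inE eqxx.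
move=> f; rewrite inE mem_rem_uniq ?enum_uniq // !inE mem_enum inE.
by case: eqVneq => //= ->.
Qed.

(* If some x_f did not commute with x_e, the ends of all such f would form a
   cycle, since at each vertex the last edge is a product of the others. *)
Lemma core_free_central (e : edge G) :
  (forall S, mcore S -> ~~ [disjoint S & ends e]) -> central e.
Proof.
move=> cf f0; apply: contrapT => nc0.
pose D := [set f | x e * x f != x f * x e].
have Dn f : f \notin D -> commute (x e) (x f) by rewrite inE negbK => /eqP.
have De f v : f \in D -> v \in ends f -> v \notin ends e.
  rewrite inE => fD vf; apply: contraNN fD => ve; apply/eqP.
  by apply: (solution_comm solx (v := v)); rewrite inE.
pose S := [set v | [exists f in D, v \in ends f]].
have DS f : f \in D -> ends f \subset S.
  by move=> fD; apply/subsetP => v vf; rewrite inE; apply/existsP; exists f; rewrite fD.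
have cS : mcore S.
  split.
    have f0D : f0 \in D by rewrite inE; apply/eqP.
    have [p [q [_ f0E]]] := ends_pair f0; apply/set0Pn; exists p.
    by apply: (subsetP (DS f0 f0D)); rewrite f0E set21.
  move=> v; rewrite inE => /existsP[f /andP[fD vf]].
  have [[g [gD vg gf]]|only] := pselect (exists g, [/\ g \in D, v \in ends g & g != f]).
    by exists f, g; rewrite eq_sym gf vf vg !DS.
  have := fD; rewrite inE => /eqP[]; rewrite (solution_factor vf) big_seq.
  apply: commute_prod => g; rewrite mem_rem_uniq ?enum_uniq // !inE mem_enum inE.
  move=> /andP[gf vg]; apply: Dn; apply/negP => gD; apply: only; by exists g.
case/negP: (cf S cS); rewrite -setI_eq0; apply/eqP/setP => v; rewrite in_set0 in_setI.
apply/negP => /andP[]; rewrite inE => /existsP[f /andP[fD vf]].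
by apply/negP; apply: De vf.
Qed.

(** Without [e], the product at either of its ends is [x e] instead of 1. So the remaining values
    solve the smaller graph up to the central involution [x e]. *)
Lemma fin_gen_delete_central (e : edge G) :
  central e -> finite_type (delete_edge e) -> fin_gen x.
Proof.
move=> ce fin; have ee := solution_sq solx e.
have [||||s [s1 sM se]] :=
  @fin_gen_central (delete_edge e) H (fun f => x (val f)) (x e) fin ee.
- by move=> f; apply: ce.
- by move=> f; left; apply: (solution_sq solx).
- by move=> v f f'; rewrite !inE => vf vf'; left;
    apply: (solution_comm solx (v := v)); rewrite inE.
- move=> v; have -> : \prod_(f <- enum (@incident (delete_edge e) v)) x (val f) =
      \prod_(f <- [seq val f | f <- enum (@incident (delete_edge e) v)]) x f.
    by rewrite big_map.
  set s := [seq _ | _ <- _].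
  have us : uniq s by rewrite map_inj_uniq ?enum_uniq //; apply: val_inj.
  have es f : (f \in s) = (f != e) && (v \in ends f).
    apply/mapP/andP => [[f' + ->]|[fe vf]].
      by rewrite mem_enum inE => vf'; split=> //; apply: (valP f').
    by exists (exist _ f fe); rewrite ?mem_enum ?inE.
  have [ve|ve] := boolP (v \in ends e).
    have : \prod_(f <- e :: s) x f = 1.
      apply: (@solution_prod _ _ x v) => //; first by rewrite /= us es eqxx.
      by move=> f; rewrite inE es inE; case: eqVneq => // ->.
    by rewrite big_cons => /mulg1_eq <-; right; rewrite mulg1 involution_inv.
  left; apply: (@solution_prod _ _ x v s) => // f; rewrite es inE.
  by case: eqVneq => // ->; rewrite (negbTE ve).
exists s; split=> // h f hs; have [->|fe] := eqVneq f e; first exact: se.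
exact: (sM h (exist _ f fe) hs).
Qed.

(** The relation at [v] says [x e = x f], so the values off [e] are a solution on the contraction,
    in which [f] takes the place of [e] at the merged vertex. *)
Lemma fin_gen_contract_deg2 (v : vertex G) (e f : edge G) :
  e != f -> incident v = [set e; f] -> ends e != ends f ->
  finite_type (contract_edge e) -> fin_gen x.
Proof.
move=> ef vE efE fin.
have ve : v \in ends e by have : e \in incident v by [rewrite vE set21]; rewrite inE.
have vf : v \in ends f by have : f \in incident v by [rewrite vE set22]; rewrite inE.
have xef : x e = x f.
  have : \prod_(g <- [:: e; f]) x g = 1.
    apply: (@solution_prod _ _ x v) => //; first by rewrite /= inE ef.
    by move=> g; rewrite vE !inE.
  rewrite big_cons big_seq1 => /mulg1_eq <-.
  by rewrite involution_inv ?(solution_sq solx).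
have [u eE uv] : exists2 u, ends e = [set u; v] & u != v.
  have [p [q [pq eE]]] := ends_pair e.
  move: ve; rewrite eE !inE => /orP[]/eqP->; last by exists p.
  by exists q; rewrite 1?setUC // eq_sym.
have ue : u \in ends e by rewrite eE set21.
have endsE w : w \in ends e -> w = u \/ w = v by rewrite eE => /set2P.
have vonly g : v \in ends g -> g = e \/ g = f.
  by move=> vg; have : g \in incident v by [rewrite inE]; rewrite vE => /set2P.
have par g : ends g = ends e -> g = e.
  move=> gE; have [|//|gf] := vonly g; first by rewrite gE.
  by rewrite -gE gf eqxx in efE.
pose y (g : edge (contract_edge e)) := x (val g).
(* Every surviving edge at the merged vertex has the value of some edge at [u]: the only one coming
   from [v] is [f], for which [e] is substituted. *)
have move_u (g : edge (contract_edge e)) w : w \in ends e -> w \in ends (val g) ->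
    exists2 g', u \in ends g' & y g = x g'.
  move=> /endsE[]->; first by exists (val g).
  move=> /vonly[ge|gf]; first by have := valP g; rewrite /= ge eqxx.
  by exists e => //; rewrite /y gf.
have cvNone w : contract_vertex e w = None -> w \in ends e.
  by rewrite /contract_vertex; case: insubP => // /negbNE.
have cvSome w w' : contract_vertex e w = Some w' -> w = val w'.
  by rewrite /contract_vertex; case: insubP => // z _ <- [->].
have yC (w : vertex (contract_edge e)) g g' :
    g \in incident w -> g' \in incident w -> commute (y g) (y g').
  rewrite !inE => /imsetP[p pg pE] /imsetP[p' pg' pE'].
  case: w pE pE' => [w|] /esym pE /esym pE'.
    apply: (solution_comm solx (v := val w)); rewrite inE.
      by rewrite -(cvSome _ _ pE).
    by rewrite -(cvSome _ _ pE').
  have [h uh ->] := move_u g p (cvNone _ pE) pg.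
  have [h' uh' ->] := move_u g' p' (cvNone _ pE') pg'.
  by apply: (solution_comm solx (v := u)); rewrite inE.
have soly : solution y.
  split=> [g|//|w]; first exact: (solution_sq solx).
  have -> : \prod_(g <- enum (incident w)) y g =
      \prod_(g <- [seq val g | g <- enum (incident w)]) x g by rewrite big_map.
  set s := [seq _ | _ <- _].
  have us : uniq s by rewrite map_inj_uniq ?enum_uniq //; apply: val_inj.
  have es g : (g \in s) = (g != e) && (w \in contract_vertex e @: ends g).
    apply/mapP/andP => [[g' + ->]|[ge wg]].
      rewrite mem_enum inE => wg'; split=> //.
      by apply: contraNneq (valP g') => ->.
    have gE : ends g != ends e by apply: contraNneq ge => /par ->.
    by exists (exist _ g gE); rewrite ?mem_enum ?inE.
  have sC : {in s &, forall g g', commute (x g) (x g')}.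
    move=> _ _ /mapP[g gN ->] /mapP[g' gN' ->].
    by apply: (yC w); rewrite -mem_enum.
  clearbody s; case: w es => [w|] es.
    apply: (@solution_prod _ _ x (val w) s) => // g; rewrite es inE.
    apply/andP/idP => [[_ /imsetP[p pg /esym/cvSome <-]] //|wg]; split.
      by apply: contraTneq wg => ->; apply: (valP w).
    apply/imsetP; exists (val w) => //; rewrite /contract_vertex insubT ?(valP w) // => h.
    by congr Some; apply: val_inj.
  have fs : f \in s.
    rewrite es eq_sym ef; apply/imsetP; exists v => //.
    by rewrite /contract_vertex insubF //; apply/negbF.
  have uf : u \notin ends f.
    by apply: contra efE => uf; rewrite (ends_mem2 uv uf vf) eE.
  have -> : \prod_(g <- s) x g = \prod_(g <- f :: rem f s) x g.
    exact: prodg_perm (perm_to_rem fs).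
  have cN w : w \in ends e -> contract_vertex e w = None.
    by move=> we; rewrite /contract_vertex insubF //; apply/negbF.
  rewrite big_cons -xef.
  have := @solution_prod _ _ x u (e :: rem f s) solx; rewrite big_cons; apply.
    by rewrite /= rem_uniq // andbT mem_rem_uniq // inE es eqxx andbF.
  move=> g; rewrite in_cons mem_rem_uniq // inE es [RHS]inE.
  have [->|ge] := eqVneq g e; first by rewrite ue.
  apply/andP/idP => [[gf /imsetP[p pg /esym/cvNone/endsE[]pE]]|ug].
  - by rewrite -pE.
  - by move: pg; rewrite pE => /vonly[] gE; rewrite gE eqxx in ge gf.
  - split; first by apply: contraNneq uf => <-.
    by apply/imsetP; exists u => //; rewrite cN.
have [s [s1 sM]] := fin _ y soly.
have sM' h g : g != e -> h \in s -> h * x g \in s.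
  move=> ge hs; have gE : ends g != ends e by apply: contraNneq ge => /par ->.
  exact: (sM h (exist _ g gE) hs).
exists s; split=> // h g hs; have [->|ge] := eqVneq g e; last exact: sM'.
by rewrite xef; apply: sM'; rewrite // eq_sym.
Qed.

End Reductions.

(** * Solutions on simple graphs *)

Definition madj (G : mgraph) (u v : vertex G) : bool :=
  [exists e : edge G, ends e == [set u; v]].

Lemma madjC (G : mgraph) : symmetric (@madj G).
Proof. by move=> u v; rewrite /madj setUC. Qed.

Lemma madjI (G : mgraph) : irreflexive (@madj G).
Proof.
move=> u; apply/negbTE/negP => /existsP[e /eqP eE]; have := card_ends e.
by rewrite eE setUid cards1.
Qed.

Lemma madjP (G : mgraph) (u v : vertex G) :
  reflect (exists e : edge G, ends e = [set u; v]) (madj u v).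
Proof. by apply: (iffP existsP) => -[e eE]; exists e; apply/eqP. Qed.

Section SimpleSolution.
Variables (G : mgraph) (H : groupType) (x : edge G -> H).
Hypothesis solx : solution x.
Hypothesis simple : forall e f : edge G, ends e = ends f -> e = f.

Let pickE (u v : vertex G) : option (edge G) := [pick e | ends e == [set u; v]].
(** The value 1 on non-adjacent pairs makes a solution on any simple graph behave like one on a
    complete graph. *)
Definition edge_val (u v : vertex G) : H := oapp x 1 (pickE u v).
Local Notation ed := edge_val.

Lemma edge_valE e u v : ends e = [set u; v] -> ed u v = x e.
Proof.
move=> eE; rewrite /edge_val /pickE; case: pickP => [f /eqP fE|/(_ e)] /=.
  by congr x; apply: simple; rewrite fE.
by rewrite eE eqxx.
Qed.

Lemma edge_valC u v : ed u v = ed v u.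
Proof. by rewrite /edge_val /pickE setUC. Qed.

Lemma edge_val_sq u v : ed u v * ed u v = 1.
Proof.
by rewrite /edge_val; case: pickE => [e|] /=; [apply: (solution_sq solx)|rewrite mulg1].
Qed.

Lemma edge_val_comm u v w : commute (ed u v) (ed u w).
Proof.
rewrite /edge_val /pickE; case: pickP => [e /eqP eE|_]; last exact/commute_sym/commute1.
case: pickP => [f /eqP fE|_]; last exact/commute1.
by apply: (solution_comm solx (v := u)); rewrite inE ?eE ?fE set21.
Qed.

Lemma edge_val_prod u (s : seq (vertex G)) : uniq s -> (forall v, madj u v -> v \in s) ->
  \prod_(v <- s) ed u v = 1.
Proof.
move=> us sT; rewrite prodg_pmap; apply: (solution_prod solx (v := u)).
  pose g e := odflt u [pick v | ends e == [set u; v]].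
  apply: (@pmap_uniq _ _ _ g) => // v; rewrite /pickE; case: pickP => //= e /eqP eE.
  rewrite /g; case: pickP => [w /eqP wE|/(_ v)] /=; last by rewrite eE eqxx.
  have uv : u != v.
    by apply/eqP => uv; have := card_ends e; rewrite eE uv setUid cards1.
  have : v \in ends e by rewrite eE set22.
  by rewrite wE => /set2P[vu|-> //]; rewrite vu eqxx in uv.
move=> e; rewrite mem_pmap inE; apply/mapP/idP => [[v _]|ue].
  by rewrite /pickE; case: pickP => // f /eqP fE [->]; rewrite fE set21.
have [v eE] : exists v, ends e = [set u; v].
  have [p [q [_ eE]]] := ends_pair e; move: ue; rewrite eE => /set2P[]->.
    by exists q.
  by exists p; rewrite setUC.
exists v; first by apply: sT; apply/madjP; exists e.
rewrite /pickE; case: pickP => [f /eqP fE|/(_ e)]; last by rewrite eE eqxx.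
by congr Some; apply: simple; rewrite fE.
Qed.

Lemma order5_central (W : {set vertex G}) : #|W| = 5 ->
  (forall u v, madj u v -> u \in W) -> forall e, central x e.
Proof.
move=> W5 WE e f.
have [[v [ve vf]]|dis] := pselect (exists v, v \in ends e /\ v \in ends f).
  by apply: (solution_comm solx (v := v)); rewrite inE.
have [a [d [ad eE]]] := ends_pair e; have [c [g [cg fE]]] := ends_pair f.
have ne u v : u \in ends e -> v \in ends f -> u != v.
  by move=> ue vf; apply: contraPneq dis => uv; apply; exists u; rewrite {2}uv.
have ae : a \in ends e by rewrite eE set21.
have de : d \in ends e by rewrite eE set22.
have cf : c \in ends f by rewrite fE set21.
have gf : g \in ends f by rewrite fE set22.
have ac := ne a c ae cf; have ag := ne a g ae gf.
have dc := ne d c de cf; have dg := ne d g de gf.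
have adW : madj a d by apply/madjP; exists e.
have cgW : madj c g by apply/madjP; exists f.
have aW := WE a d adW; have dW := WE d a (etrans (madjC d a) adW).
have cW := WE c g cgW; have gW := WE g c (etrans (madjC g c) cgW).
have [b bE] : exists b, W :\: [set a; d; c; g] = [set b].
  apply/cards1P; have sub : [set a; d; c; g] \subset W.
    by apply/subsetP => v; rewrite !inE => /orP[/orP[/orP[]|]|] /eqP->.
  have := cardsID [set a; d; c; g] W; rewrite (setIidPr sub) W5.
  have -> : #|[set a; d; c; g]| = 4.
    rewrite setUC cardsU1 setUC cardsU1 cards2 !inE !negb_or ad.
    by rewrite [c == a]eq_sym [c == d]eq_sym ![g == _]eq_sym ag dg cg ac dc.
  by move=> e1; apply/eqP; move: e1; clear; lia.
have : b \in W :\: [set a; d; c; g] by rewrite bE set11.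
rewrite !inE !negb_or -!andbA => /and5P[ba bd bc bg _].
have inW v : v \in W -> [\/ v = a, v = b, v = c | v = d \/ v = g].
  move=> vW; have [vb|vb] := eqVneq v b; first by constructor 2.
  have : v \notin W :\: [set a; d; c; g] by rewrite bE inE.
  rewrite !inE vW andbT negbK -!orbA => /or4P[]/eqP->.
  - by constructor 1.
  - by constructor 4; left.
  - by constructor 3.
  - by constructor 4; right.
have nbr u v : madj u v -> u != v /\ v \in W.
  move=> uv; split; last by apply: (WE v u); rewrite madjC.
  by apply: contraTneq uv => ->; rewrite madjI.
have prod4 u p q r s : uniq [:: p; q; r; s] ->
    (forall v, v \in W -> v != u -> v \in [:: p; q; r; s]) ->
    ed u p * (ed u q * (ed u r * ed u s)) = 1.
  move=> us sub; have := @edge_val_prod u [:: p; q; r; s] us.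
  rewrite !big_cons big_nil mulg1; apply=> v /nbr[uv vW].
  by apply: sub; rewrite // eq_sym.
have solve g1 h1 : g1 * g1 = 1 -> g1 * h1 = 1 -> g1 = h1 :> H.
  by move=> gg gh; apply: (mulgI g1); rewrite gg gh.
have sq := edge_val_sq.
rewrite -(edge_valE eE) -(edge_valE fE).
(* The two disjoint edges [a d] and [c g] are placed on the crossing pair; [g] plays the vertex
   called e there, and [b] is the fifth vertex. *)
apply: (@K5_commute H (ed a b) (ed a c) (ed a d) (ed a g) (ed b c) (ed b d) (ed b g)
  (ed c d) (ed c g) (ed d g)) => //.
- apply: solve => //; rewrite -mulgA; apply: prod4.
    by rewrite /= !inE !negb_or bc bd bg cg dg [c == d]eq_sym dc.
  by move=> v /inW[->|->|->|[]->]; rewrite !inE ?eqxx ?orbT.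
- rewrite edge_valC; apply: solve => //; rewrite -mulgA; apply: prod4.
    by rewrite /= !inE !negb_or ac ad ag cg dg [c == d]eq_sym dc.
  by move=> v /inW[->|->|->|[]->]; rewrite !inE ?eqxx ?orbT.
- rewrite ![ed _ g]edge_valC; have := @prod4 g a b d c.
  rewrite !mulgA -mulgA => prod.
  apply: (mulIg (ed g d * ed g c)); rewrite prod.
  + by rewrite -mulgA [ed g d * (ed g d * _)]mulgA sq mul1g sq.
  + by rewrite /= !inE !negb_or bc bd ac ad dc eq_sym ba.
  + by move=> v /inW[->|->|->|[]->]; rewrite !inE ?eqxx ?orbT.
- rewrite [ed a d]edge_valC [ed b d]edge_valC [ed c d]edge_valC.
  have := @prod4 d a g b c; rewrite !mulgA => prod.
  apply: (mulIg (ed d c)); rewrite prod ?sq //.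
    by rewrite /= !inE !negb_or ag ac bc [g == b]eq_sym bg [g == c]eq_sym cg eq_sym ba.
  by move=> v /inW[->|->|->|[]->]; rewrite !inE ?eqxx ?orbT.
- rewrite [ed a c]edge_valC [ed b c]edge_valC; apply: solve => //; rewrite -mulgA.
  apply: prod4.
    by rewrite /= !inE !negb_or ag ad [g == d]eq_sym dg [g == b]eq_sym bg
      [d == b]eq_sym bd [a == b]eq_sym ba.
  by move=> v /inW[->|->|->|[]->]; rewrite !inE ?eqxx ?orbT.
Qed.

End SimpleSolution.

(** * Graphs of the form [K_{3,n}] *)

Section K3n.
Variables (G : mgraph) (p : 'I_3 -> vertex G) (R : {set vertex G}).
Hypothesis simple : forall e f : edge G, ends e = ends f -> e = f.
Hypothesis p_inj : injective p.
Hypothesis pR : forall i, p i \notin R.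
Hypothesis adj_pR : forall i r, r \in R -> madj (p i) r.

Lemma K36_minor : 5 < #|R| -> minor (complete_bipartite 3 6) G.
Proof.
move=> R6; pose s := enum R; have ss : size s = #|R| by rewrite -cardE.
have ltj (j : 'I_6) : (j < size s)%N by rewrite ss (leq_trans (ltn_ord j)).
pose r (j : 'I_6) := nth (p ord0) s j.
have rR j : r j \in R by rewrite -mem_enum mem_nth.
pose vmap (v : vertex (complete_bipartite 3 6)) : vertex G :=
  match v with inl i => p i | inr j => r j end.
have /choice[g gE] : forall e : 'I_3 * 'I_6, exists f : edge G, ends f = [set p e.1; r e.2].
  by move=> e; apply/madjP/adj_pR.
have r_inj : injective r.
  by move=> i j /eqP; rewrite nth_uniq ?enum_uniq // => /eqP/val_inj.
have npr i j : p i <> r j by move=> ij; have := pR i; rewrite ij rR.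
apply: (@embed_minor _ _ vmap g).
- by case=> i [j|j] //= => [/p_inj->|/npr|/esym/npr|/r_inj->].
- move=> [i j] [i' j'] gg; have := gE (i, j); rewrite gg gE /= => E.
  have : p i' \in [set p i; r j] by rewrite -E set21.
  move=> /set2P[/p_inj->|/npr //].
  have : r j' \in [set p i; r j] by rewrite -E set22.
  by move=> /set2P[/esym/npr //|/r_inj->].
- move=> [i j]; rewrite gE; apply/setP => v; apply/set2P/imsetP => [[]->|[w]].
  + by exists (inl i); rewrite // !inE eqxx.
  + by exists (inr j); rewrite // !inE eqxx orbT.
  + by rewrite !inE => /orP[]/eqP-> ->; [left|right].
Qed.

Variables (H : groupType) (x : edge G -> H).
Hypothesis solx : solution x.
Hypothesis edges : forall e : edge G, exists i r, r \in R /\ ends e = [set p i; r].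

Lemma K3n_fin_gen : #|R| <= 5 -> fin_gen x.
Proof.
move=> R5; pose s := enum R; have ss : size s = #|R| by rewrite -cardE.
pose ed := edge_val x.
(* With fewer than five vertices in [R], the missing columns are filled with 1, which keeps all
   relations of the 3 by 5 array. *)
pose a k (i : 'I_5) : H := if (i < size s)%N then ed (p k) (nth (p ord0) s i) else 1.
have aa k i : a k i * a k i = 1.
  by rewrite /a; case: ifP => _; [apply: edge_val_sq|rewrite mulg1].
have aC k i j : commute (a k i) (a k j).
  rewrite /a; case: ifP => _; last exact/commute_sym/commute1.
  by case: ifP => _; [apply: edge_val_comm|apply: commute1].
have ab k l i : commute (a k i) (a l i).
  rewrite /a; case: ifP => _; last exact: commute1.
  by rewrite /ed ![edge_val _ _ (nth _ _ _)]edge_valC; apply: edge_val_comm.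
have madj_nbr u v : madj u v -> exists i r, r \in R /\
    (u = p i /\ v = r \/ u = r /\ v = p i).
  move=> uv; have /madjP[e eE] := uv; have [i [r [rR eE']]] := edges e.
  exists i, r; split=> //; rewrite eE in eE'.
  have uvn : u != v by apply: contraTneq uv => ->; rewrite madjI.
  have /set2P[ui|ur] : u \in [set p i; r] by rewrite -eE' set21.
    have /set2P[vi|//] : v \in [set p i; r] by rewrite -eE' set22.
      by rewrite ui vi eqxx in uvn.
    by left.
  have /set2P[vi|vr] : v \in [set p i; r] by rewrite -eE' set22.
    by right.
  by rewrite ur vr eqxx in uvn.
have prodp k : \prod_(i < 5) a k i = 1.
  have prods : \prod_(r <- s) ed (p k) r = 1.
    apply: edge_val_prod; rewrite ?enum_uniq // => v /madj_nbr[i [r [rR]]] [[_ ->]|[pr _]].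
      by rewrite mem_enum.
    by have := pR k; rewrite pr rR.
  rewrite -[RHS]prods [RHS](big_nth (p ord0)).
  rewrite -(big_mkord predT (fun i => if (i < size s)%N then ed (p k) (nth (p ord0) s i) else 1)).
  rewrite (@big_cat_nat _ _ _ (size s)) //= ?ss // -ss [X in _ * X]big_nat_cond.
  rewrite [X in _ * X]big1 ?mulg1 => [|i]; last first.
    by rewrite andbT => /andP[si _]; rewrite ltnNge si.
  rewrite big_nat_cond [RHS]big_nat_cond; apply: eq_bigr => i.
  by rewrite andbT => /andP[_ ->].
pose o k : 'I_3 := inord k.
have oE i : [\/ i = o 0%N, i = o 1%N | i = o 2%N].
  case: i => -[|[|[|//]]] ?; [constructor 1|constructor 2|constructor 3];
  by apply: val_inj; rewrite /= inordK.
have oN i j : (i < 3)%N -> (j < 3)%N -> i != j -> o i != o j.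
  by move=> i3 j3; apply: contraNneq => /(congr1 val); rewrite /= !inordK // => ->.
have cE i : a (o 2%N) i = a (o 0%N) i * a (o 1%N) i.
  rewrite /a; case: ifP => si; last by rewrite mulg1.
  set r := nth _ _ _; have rR : r \in R by rewrite -mem_enum mem_nth.
  have : \prod_(v <- [:: p (o 1%N); p (o 0%N); p (o 2%N)]) ed r v = 1.
    apply: edge_val_prod => //.
      by rewrite /= !inE !(inj_eq p_inj) negb_or !oN.
    move=> v /madj_nbr[i' [r' [r'R]]] [[ri _]|[_ ->]].
      by have := pR i'; rewrite -ri rR.
    by case: (oE i') => ->; rewrite !inE eqxx ?orbT.
  have edC u v : ed u v = ed v u by apply: edge_valC.
  rewrite !big_cons big_nil mulg1 mulgA [ed (p (o 2%N)) r]edC => /mulg1_eq <-.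
  rewrite invgM !involution_inv; try exact: edge_val_sq.
  by rewrite [ed r (p (o 0%N))]edC [ed r (p (o 1%N))]edC.
have [t [t1 ta tb tc]] := @K35_fin_gen H (a (o 0%N)) (a (o 1%N)) (a (o 2%N))
  (aa _) (aa _) (aC _) (aC _) (aC _) (ab _ _) cE (prodp _) (prodp _).
exists t; split=> // h e ht.
have [i [r [rR eE]]] := edges e; rewrite -(edge_valE x simple eE).
have rs : (index r s < size s)%N by rewrite index_mem mem_enum.
have r5 : (index r s < 5)%N by rewrite (leq_trans rs) // ss.
have -> : edge_val x (p i) r = a i (Ordinal r5).
  by rewrite /a /= rs nth_index // mem_enum.
by case: (oE i) => ->; [apply: ta|apply: tb|apply: tc].
Qed.

End K3n.

(** * Excluding both minors *)

Theorem minor_free_finite_type (G : mgraph) :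
  ~ minor (disj_union C2 C2) G -> ~ minor (complete_bipartite 3 6) G -> finite_type G.
Proof.
have [n] := ubnP #|edge G|; elim: n G => // n IHn G Gn no2 no36 H x solx.
have meet (S T : {set vertex G}) : mcore S -> mcore T -> ~~ [disjoint S & T].
  by move=> cS cT; apply/negP => dST; apply: no2; apply: disjoint_mcores_minor dST.
have [[e ce]|nc] := pselect (exists e, central x e).
  apply: (fin_gen_delete_central solx ce); apply: IHn.
  - rewrite /= card_sig; apply: leq_trans (_ : _ <= #|edge G|)%N _ => //.
    apply: proper_card; apply/properP; split; first exact/subsetP.
    by exists e; rewrite // !inE eqxx.
  - by move=> m; apply/no2/minor_delete_edge/m.
  - by move=> m; apply/no36/minor_delete_edge/m.
have {}nc e : ~ central x e by move=> ce; apply: nc; exists e.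
(* The ends of two parallel edges form a core, which meets every other core; so such an edge would
   be central. *)
have simple (e f : edge G) : ends e = ends f -> e = f.
  move=> efE; apply/eqP/negPn/negP => ef; case: (nc e).
  apply: (core_free_central solx) => S cS; apply: meet cS _.
  have [p [q [pq eE]]] := ends_pair e.
  split; first by rewrite eE; apply/set0Pn; exists p; rewrite set21.
  by move=> v ve; exists e, f; rewrite -efE.
have [[v v2]|deg2] := pselect (exists v : vertex G, #|incident v| = 2).
  have /eqP/cards2P[e [f [ef vE]]] := v2.
  apply: (fin_gen_contract_deg2 solx ef vE); first by apply: contra_neq ef; apply: simple.
  apply: IHn.
  - rewrite /= card_sig; apply: leq_trans (_ : _ <= #|edge G|)%N _ => //.
    apply: proper_card; apply/properP; split; first exact/subsetP.
    by exists e; rewrite // !inE eqxx.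
  - by move=> m; apply/no2/minor_contract_edge/m.
  - by move=> m; apply/no36/minor_contract_edge/m.
(* An edge alone at a vertex has value 1 there and would be central. *)
have deg1 (v : vertex G) : #|incident v| != 1%N.
  apply/negP => /cards1P[e vE]; case: (nc e) => f.
  have -> : x e = 1; last exact/commute_sym/commute1.
  have := @solution_prod _ _ x v [:: e] solx; rewrite big_seq1; apply=> // g.
  by rewrite vE !inE.
have other v (e : edge G) : v \in ends e -> exists2 w, ends e = [set v; w] & v != w.
  have [p [q [pq eE]]] := ends_pair e; rewrite eE => /set2P[]->; first by exists q.
  by exists p; rewrite 1?setUC // eq_sym.
pose adj := @madj G.
have adj_ends u v (e : edge G) : ends e = [set u; v] -> adj u v.
  by move=> eE; apply/madjP; exists e.
have core_mcore S : core adj S -> mcore S.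
  move=> [S0 cS]; split=> // v vS; have /deg_gt1P[y [z [yS zS yz vy vz]]] := cS v vS.
  have /madjP[e eE] := vy; have /madjP[f fE] := vz.
  have sub w (g : edge G) : w \in S -> ends g = [set v; w] -> ends g \subset S.
    by move=> wS ->; apply/subsetP => u /set2P[]->.
  exists e, f; split; rewrite ?eE ?fE ?set21 //; last 2 first.
  - by rewrite -eE; apply: sub eE.
  - by rewrite -fE; apply: sub fE.
  apply: contraNneq yz => ef; apply/eqP.
  have : y \in [set v; z] by rewrite -fE -ef eE set22.
  by move=> /set2P[yv|//]; rewrite yv /adj madjI in vy.
have mcore_core S : mcore S -> core adj S.
  move=> [S0 cS]; split=> // v vS; have [e [f [ef ve vf eS fS]]] := cS v vS.
  have [y eE vy] := other v e ve; have [z fE vz] := other v f vf.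
  apply/deg_gt1P; exists y, z; split.
  - by apply: (subsetP eS); rewrite eE set22.
  - by apply: (subsetP fS); rewrite fE set22.
  - by apply: contraNneq ef => yz; apply/eqP/simple; rewrite eE fE yz.
  - exact: adj_ends eE.
  - exact: adj_ends fE.
have adj_big u v : adj u v -> u \in big_vertices adj.
  move=> uv; have /madjP[e eE] := uv.
  have : 2 < #|incident u|.
    have i0 : 0 < #|incident u| by apply/card_gt0P; exists e; rewrite inE eE set21.
    have := deg1 u; have : #|incident u| != 2 by apply/eqP => u2; apply: deg2; exists u.
    by move: i0; clear; lia.
  case/card_gt2P => e1 [e2 [e3 [[]]]]; rewrite !inE => u1 u2 u3 [n12 n23 n31].
  have [w1 E1 _] := other u e1 u1; have [w2 E2 _] := other u e2 u2.
  have [w3 E3 _] := other u e3 u3.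
  apply/card_gt2P; exists w1, w2, w3; split.
    by rewrite !inE (adj_ends u w1 e1) // (adj_ends u w2 e2) // (adj_ends u w3 e3).
  split.
  - by apply: contraNneq n12 => w; apply/eqP/simple; rewrite E1 E2 w.
  - by apply: contraNneq n23 => w; apply/eqP/simple; rewrite E2 E3 w.
  - by apply: contraNneq n31 => w; apply/eqP/simple; rewrite E3 E1 w.
have no_disjoint (S T : {set vertex G}) : core adj S -> core adj T ->
    exists2 v, v \in S & v \in T.
  move=> /core_mcore cS /core_mcore cT; have := meet S T cS cT.
  rewrite -setI_eq0 => /set0Pn[v]; rewrite in_setI => /andP[vS vT].
  by exists v.
(* If every cycle met the ends of the edge, it would be central by [core_free_central]. *)
have edge_core u v : adj u v -> exists S, [/\ core adj S, u \notin S & v \notin S].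
  move=> /madjP[e eE]; apply: contrapT => nS; case: (nc e).
  apply: (core_free_central solx) => S cS; apply/negP => dS; apply: nS; exists S.
  split; first exact: mcore_core.
    by apply: contraTN dS => uS; apply/negP => /disjointFr/(_ uS); rewrite eE set21.
  by apply: contraTN dS => uS; apply/negP => /disjointFr/(_ uS); rewrite eE set22.
have [W0|W0] := eqVneq (big_vertices adj) set0.
  exists [:: 1]; split; rewrite ?mem_head // => h e.
  have [p [q [pq eE]]] := ends_pair e; have := adj_big p q (adj_ends p q e eE).
  by rewrite W0 inE.
have [W5|] :=
  order5_or_K3n (@madjC G) (@madjI G) no_disjoint adj_big edge_core W0.
  (* On five vertices every edge is central, so it is enough to produce one edge. *)
  have [v vW] := set0Pn _ W0.
  have /card_gt0P[w] : 0 < deg adj setT v.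
    by move: vW; rewrite inE; clear; lia.
  rewrite !inE => /madjP[e _]; case: (nc e).
  exact: (order5_central solx simple W5 adj_big).
move=> [p0 [p1 [p2 /=]]]; set P := [set p0; p1; p2].
move=> [[n01 n02 n12] [PP RR PR]]; set R := big_vertices adj :\: P in RR PR.
pose p (i : 'I_3) : vertex G := nth p0 [:: p0; p1; p2] i.
have pP i : p i \in P.
  by case: i => -[|[|[|//]]] ? /=; rewrite !inE eqxx ?orbT.
have Pp v : v \in P -> exists i, v = p i.
  rewrite !inE -orbA => /or3P[]/eqP->.
  - by exists (Ordinal (isT : 0 < 3)%N).
  - by exists (Ordinal (isT : 1 < 3)%N).
  - by exists (Ordinal (isT : 2 < 3)%N).
have p_inj : injective p.
  move=> i j /eqP; rewrite nth_uniq //= ?inE ?negb_or ?n01 ?n02 ?n12 //.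
  by move=> /eqP/val_inj.
have pR i : p i \notin R by rewrite in_setD pP.
have adj_pR i r : r \in R -> madj (p i) r by move=> rR; rewrite madjC; apply: PR.
have [R6|R5] := ltnP 5 #|R|.
  by case: no36; apply: (K36_minor p_inj pR adj_pR R6).
apply: (K3n_fin_gen simple p_inj pR solx _ R5) => e.
have [u [v [uv eE]]] := ends_pair e.
have auv := adj_ends u v e eE; have uW := adj_big u v auv.
have avu : adj v u by rewrite /adj madjC.
have vW := adj_big v u avu.
have inR w : w \in big_vertices adj -> w \notin P -> w \in R.
  by move=> wW wP; rewrite in_setD wP.
have [uP|uP] := boolP (u \in P).
  have vP : v \notin P by apply: contraTN auv => vP; rewrite /adj (PP u v).
  by have [i uE] := Pp u uP; exists i, v; rewrite -uE; split=> //; apply: inR.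
have vP : v \in P.
  by apply: contraTT auv => vP; rewrite /adj (RR u v) ?inR.
by have [i vE] := Pp v vP; exists i, u; rewrite -vE setUC; split=> //; apply: inR.
Qed.

From mathcomp Require Import classical_sets cardinality.

Local Close Scope group_scope.

Theorem theorem1p4 (G : mgraph) (b : vertex G -> 'Z_2) :
  finite_set [set: incidence_group b]%classic <->
  ~ minor (disj_union C2 C2) G /\ ~ minor (complete_bipartite 3 6) G.
Proof.
split=> [/finite_seqP[s sE]|[no2 no36]].
  have sT q : q \in s by have : [set: incidence_group b]%classic q by []; rewrite sE.
  have finG := incidence_seq_finite_type sT.
  split=> m; [apply: C2_C2_infinite|apply: K36_infinite];
  exact: minor_finite_type m finG.
have [s sT] := finite_type_incidence_seq b (minor_free_finite_type no2 no36).
by apply/finite_seqP; exists s; apply/seteqP; split=> q //= _; apply: sT.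
Qed.
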